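(* Let $t\in[0,1)$. Let $X$ belong to any one of the sets $\{d_p,\ell^p:1\le p<\infty\}\cup\{ces(p):1<p<\infty\}$, or $\{\ell(p+),ces(p+),d(p+):1\le p<\infty\}$, or $\{\ell(p-),ces(p-),d(p-):1<p\le\infty\}$. Then $C_t\in\mathcal{L}(X)$ is power bounded and uniformly mean ergodic, but not supercyclic.
   Context: $\mathbb{N}_0=\{0,1,2,\dots\}$ and $\omega:=\mathbb{C}^{\mathbb{N}_0}$. For $t\in[0,1]$, $C_tx:=\left(\frac{t^nx_0+t^{n-1}x_1+\dots+x_n}{n+1}\right)_{n\in\mathbb{N}_0}$ for $x\in\omega$ (with $0^0:=1$); $C_t$ acts on a sequence space $X\subseteq\omega$ by restriction. Banach spaces: $\ell^q=\ell^q(\mathbb{N}_0)$ with its usual norm $\|\cdot\|_q$, $1\le q<\infty$; $ces(q):=\{x\in\omega: C_1|x|\in\ell^q\}$ with norm $\|x\|_{ces(q)}:=\|C_1|x|\,\|_q$, $1<q<\infty$, where $|x|=(|x_n|)_n$; $d_q:=\{x\in\ell^\infty:\hat x\in\ell^q\}$ with norm $\|x\|_{d_q}:=\|\hat x\|_q$, $1\le q<\infty$, where $\hat x:=(\sup_{k\ge n}|x_k|)_{n\in\mathbb{N}_0}$. Fréchet spaces: for $1\le p<\infty$ and a strictly decreasing sequence $(p_k)_{k\in\mathbb{N}}\subseteq(p,\infty)$ with $p_k\downarrow p$, $\ell(p+):=\bigcap_k\ell^{p_k}$, $ces(p+):=\bigcap_k ces(p_k)$, $d(p+):=\bigcap_k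 d_{p_k}$, with the topology generated by the corresponding norms $\|\cdot\|_{p_k}$, $\|\cdot\|_{ces(p_k)}$, $\|\cdot\|_{d_{p_k}}$, $k\in\mathbb{N}$. (LB)-spaces: for $1<p\le\infty$ and a strictly increasing sequence $(p_k)_{k\in\mathbb{N}}\subseteq(1,p)$ with $p_k\uparrow p$, $\ell(p-):=\mathrm{ind}_k\,\ell^{p_k}$, $ces(p-):=\mathrm{ind}_k\,ces(p_k)$, $d(p-):=\mathrm{ind}_k\,d_{p_k}$, i.e. the union of the respective Banach spaces with the finest locally convex topology making all their inclusions continuous. For a locally convex Hausdorff space $X$, $\mathcal{L}(X)$ is the space of continuous linear operators on $X$ and $\mathcal{L}_b(X)$ is $\mathcal{L}(X)$ with the topology of uniform convergence on bounded sets. $T\in\mathcal{L}(X)$ is power bounded if $\{T^n:n\in\mathbb{N}\}$ is equicontinuous; uniformly mean ergodic if $T_{[n]}:=\frac1n\sum_{m=1}^nT^m$ converges in $\mathcal{L}_b(X)$ as $n\to\infty$; supercyclic if there is $x\in X$ such that $\{\lambda T^nx:\lambda\in\mathbb{C},\ n\in\mathbb{N}_0\}$ is dense in $X$. *)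

(* Defs.v *)
From HB Require Import structures.
From mathcomp Require Import all_boot all_order all_algebra.
From mathcomp Require Import finmap.
From mathcomp Require Import all_classical all_reals all_analysis.
From mathcomp Require Import complex.

Set Implicit Arguments.
Unset Strict Implicit.
Unset Printing Implicit Defensive.
Import Order.TTheory GRing.Theory Num.Theory.
Import numFieldNormedType.Exports.

Local Open Scope classical_set_scope.
Local Open Scope ring_scope.

Notation normc := ComplexField.Normc.normc.

Section lq.
Context {R : realType}.
Implicit Types (a b : nat -> R) (q r : R).

Definition lqnorm q a : \bar R := ('N[counting]_q%:E[EFin \o a])%E.

Lemma lqnormE q a : 0 < q ->
  lqnorm q a = ((\sum_(k <oo) (`|a k| `^ q)%:E) `^ q^-1)%E.
Proof. by move=> q0; rewrite /lqnorm Lnorm_counting. Qed.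

Lemma lqnorm_ge0 q a : (0 <= lqnorm q a)%E.
Proof. exact: Lnorm_ge0. Qed.

Let series_ge0 q a : (0 <= \sum_(k <oo) (`|a k| `^ q)%:E)%E.
Proof. by apply: nneseries_ge0 => n _ _; rewrite lee_fin powR_ge0. Qed.

Lemma lqnorm_ltyE q a : 0 < q ->
  (lqnorm q a < +oo)%E = (\sum_(k <oo) (`|a k| `^ q)%:E < +oo)%E.
Proof.
move=> q0; rewrite lqnormE//; apply/idP/idP; last exact: poweR_lty.
by apply: lty_poweRy; rewrite invr_neq0// gt_eqF.
Qed.

Lemma lqnorm_le q a b : 0 < q -> (forall n, `|a n| <= `|b n|) ->
  (lqnorm q a <= lqnorm q b)%E.
Proof.
move=> q0 ab; rewrite !lqnormE//; apply: gt0_ler_poweR.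
- by rewrite invr_ge0 ltW.
- by rewrite in_itv/= leey series_ge0.
- by rewrite in_itv/= leey series_ge0.
- apply: lee_nneseries => [n _ _|n _]; first by rewrite lee_fin powR_ge0.
  by rewrite lee_fin ge0_ler_powR// ?nnegrE// ltW.
Qed.

Lemma lqnormD q a b : 1 <= q ->
  (lqnorm q (fun n => a n + b n)%R <= lqnorm q a + lqnorm q b)%E.
Proof. by move=> q1; apply: minkowski_EFin. Qed.

Lemma lqnormZ q c a : 1 <= q ->
  (lqnorm q (fun n => c * a n)%R = `|c|%:E * lqnorm q a)%E.
Proof.
move=> q1; have q0 : 0 < q by exact: lt_le_trans q1.
rewrite !lqnormE//.
under eq_eseriesr do rewrite normrM powRM// EFinM.
rewrite nneseriesZl; last by move=> n _; rewrite lee_fin powR_ge0.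
rewrite poweRM ?lee_fin ?powR_ge0//.
by rewrite poweR_EFin -powRrM mulfV ?gt_eqF// powRr1.
Qed.

Lemma lqnorm_ge q a n : 0 < q -> (`|a n|%:E <= lqnorm q a)%E.
Proof.
move=> q0.
have -> : `|a n|%:E = ((`|a n| `^ q)%:E `^ q^-1)%E.
  by rewrite poweR_EFin -powRrM mulfV ?gt_eqF// powRr1.
rewrite lqnormE//; apply: gt0_ler_poweR.
- by rewrite invr_ge0 ltW.
- by rewrite in_itv/= leey lee_fin powR_ge0.
- by rewrite in_itv/= leey series_ge0.
- have h k : (0 <= (`|a k| `^ q)%:E)%E by rewrite lee_fin powR_ge0.
  apply: le_trans (nneseries_lim_ge n.+1 _) => //.
  by rewrite big_nat_recr//= leeDr// sume_ge0.
Qed.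

Lemma lqnorm_mono q r a : 0 < q -> q <= r ->
  (lqnorm q a < +oo)%E -> (lqnorm r a < +oo)%E.
Proof.
move=> q0 qr aoo; have r0 : 0 < r by exact: lt_le_trans qr.
pose M := fine (lqnorm q a).
have aM n : `|a n| <= M.
  by rewrite -lee_fin fineK ?lqnorm_ge// ge0_fin_numE ?lqnorm_ge0.
have M0 : 0 <= M by exact: le_trans (aM 0).
move: aoo; rewrite !lqnorm_ltyE// => aoo.
apply: (@le_lt_trans _ _ (\sum_(k <oo) ((M `^ (r - q))%:E * (`|a k| `^ q)%:E))%E).
  apply: lee_nneseries => [n _ _|n _]; first by rewrite lee_fin powR_ge0.
  rewrite -EFinM lee_fin.
  have [->|an0] := eqVneq (a n) 0.
    by rewrite normr0 powR0 ?gt_eqF// mulr_ge0 ?powR_ge0.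
  rewrite -[leLHS](_ : `|a n| `^ (r - q) * `|a n| `^ q = _); last first.
    by rewrite -powRD ?subrK// normr_eq0 an0 implybT.
  by rewrite ler_wpM2r ?powR_ge0// ge0_ler_powR ?nnegrE ?subr_ge0.
rewrite nneseriesZl; last by move=> n _; rewrite lee_fin powR_ge0.
by rewrite lte_mul_pinfty// lee_fin powR_ge0.
Qed.

End lq.

Definition cesaro_op (K : fieldType) (t : K) (x : nat -> K) : nat -> K :=
  fun n => (\sum_(k < n.+1) t ^+ (n - k) * x k) / n.+1%:R.

Section complex_modulus.
Context {R : realType}.
Implicit Types z w : R[i].

Lemma normc_ge0 z : 0 <= normc z.
Proof. by have := normr_ge0 z; rewrite normc_def -lecR -(normc_def z). Qed.

Lemma normcZ z w : normc (z * w) = normc z * normc w.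
Proof. exact: ComplexField.Normc.normcM. Qed.

Lemma normcD z w : normc (z + w) <= normc z + normc w.
Proof. exact: le_normcD. Qed.

Lemma normr_normc z : `|z| = (normc z)%:C%C.
Proof. by []. Qed.

Lemma normc0 : normc (0 : R[i]) = 0.
Proof. by rewrite ComplexField.Normc.normc0. Qed.

End complex_modulus.

Section scales.
Context {R : realType}.
Local Notation omega := (nat -> R[i]).
Implicit Types (x y : omega) (a : R[i]).

(* A scale of sequence spaces: for every exponent q it gives the space of all
   x in [dom] with [maj x] in l^q, normed by the l^q norm of [maj x]. *)
Record scale := Scale {
  dom : set omega;
  maj : omega -> nat -> R;
  dom0 : dom 0;
  domP : forall a x y, dom x -> dom y -> dom (a *: x + y);
  maj_ge0 : forall x n, 0 <= maj x n;
  majD : forall x y n, dom x -> dom y -> maj (x + y) n <= maj x n + maj y n;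
  majZ : forall a x n, dom x -> maj (a *: x) n = normc a * maj x n;
  maj_eq0 : forall x, dom x -> (forall n, maj x n = 0) -> x = 0 }.

Definition modulus x : nat -> R := fun n => normc (x n).

Definition linfty : set omega := [set x | exists M, forall n, modulus x n <= M].

(* The least decreasing majorant of |x|; it is meaningful for x in l^oo only,
   as [sup] is 0 on unbounded sets. *)
Definition hat x : nat -> R :=
  fun n => sup [set modulus x k | k in [set k | (n <= k)%N]].

Lemma modulus_eq0 x : (forall n, modulus x n = 0) -> x = 0.
Proof.
by move=> x0; apply/funext => n; exact: (ComplexField.Normc.eq0_normc (x0 n)).
Qed.

Lemma modulusD x y n : modulus (x + y) n <= modulus x n + modulus y n.
Proof. exact: normcD. Qed.

Lemma modulusZ a x n : modulus (a *: x) n = normc a * modulus x n.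
Proof. exact: normcZ. Qed.

Lemma modulus_ge0 x n : 0 <= modulus x n.
Proof. exact: normc_ge0. Qed.

Lemma linftyP a x y : linfty x -> linfty y -> linfty (a *: x + y).
Proof.
move=> [M xM] [N yN]; exists (normc a * M + N) => n.
apply: le_trans (modulusD _ _ _) _; rewrite modulusZ lerD//.
by rewrite ler_wpM2l ?normc_ge0.
Qed.

Lemma linfty0 : linfty 0.
Proof. by exists 0 => n; rewrite /modulus normc0. Qed.

Definition cesaro_modulus x : nat -> R := cesaro_op 1 (modulus x).

Lemma cesaro_modulusE x n :
  cesaro_modulus x n = (\sum_(k < n.+1) modulus x k) / n.+1%:R.
Proof.
by rewrite /cesaro_modulus /cesaro_op; under eq_bigr do rewrite expr1n mul1r.
Qed.

Lemma cesaro_modulus_ge0 x n : 0 <= cesaro_modulus x n.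
Proof.
by rewrite cesaro_modulusE divr_ge0// sumr_ge0// => k _; exact: modulus_ge0.
Qed.

Lemma cesaro_modulusD x y n :
  cesaro_modulus (x + y) n <= cesaro_modulus x n + cesaro_modulus y n.
Proof.
rewrite !cesaro_modulusE -mulrDl -big_split/=.
by rewrite ler_wpM2r ?invr_ge0// ler_sum// => k _; exact: modulusD.
Qed.

Lemma cesaro_modulusZ a x n :
  cesaro_modulus (a *: x) n = normc a * cesaro_modulus x n.
Proof.
rewrite !cesaro_modulusE mulrA; congr (_ / _).
by rewrite mulr_sumr; apply: eq_bigr => k _; exact: modulusZ.
Qed.

Lemma cesaro_modulus_eq0 x : (forall n, cesaro_modulus x n = 0) -> x = 0.
Proof.
move=> h; apply: modulus_eq0 => n; move: (h n); rewrite cesaro_modulusE => /eqP.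
rewrite mulf_eq0 invr_eq0 pnatr_eq0 orbF psumr_eq0; last first.
  by move=> k _; exact: modulus_ge0.
by move=> /allP/(_ ord_max); rewrite mem_index_enum => /(_ isT)/= /eqP.
Qed.

Lemma le_hat x n k : linfty x -> (n <= k)%N -> modulus x k <= hat x n.
Proof.
move=> [M xM] nk; apply: sup_ubound; last by exists k.
by exists M => _ [j _ <-].
Qed.

Lemma hat_le x n (M : R) :
  (forall k, (n <= k)%N -> modulus x k <= M) -> hat x n <= M.
Proof.
move=> xM; apply: sup_le_ub; first by exists (modulus x n), n => /=.
by move=> _ [k nk <-]; exact: xM.
Qed.

Lemma hat_ge0 x n : 0 <= hat x n.
Proof.
rewrite /hat; set A := (X in sup X).
have [supA|] := pselect (has_sup A); last by move/sup_out->.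
apply: (le_trans (modulus_ge0 x n)); apply: sup_ubound; first exact: supA.2.
by exists n => //=.
Qed.

Lemma hatD x y n : linfty x -> linfty y -> hat (x + y) n <= hat x n + hat y n.
Proof.
move=> dx dy; apply: hat_le => k nk.
by apply: le_trans (modulusD _ _ _) _; rewrite lerD// le_hat.
Qed.

Lemma hatZ a x n : linfty x -> hat (a *: x) n = normc a * hat x n.
Proof.
move=> dx; have dax : linfty (a *: x).
  by rewrite -[_ *: _]addr0; apply: linftyP => //; exact: linfty0.
apply/eqP; rewrite eq_le; apply/andP; split.
  apply: hat_le => k nk; rewrite modulusZ ler_wpM2l ?normc_ge0//.
  exact: le_hat.
have [->|a0] := eqVneq a 0.
  by rewrite normc0 mul0r hat_ge0.
have na0 : 0 < normc a.
  rewrite lt_def normc_ge0 andbT; apply: contra_neq a0 => h.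
  exact: ComplexField.Normc.eq0_normc.
rewrite mulrC -ler_pdivlMr//; apply: hat_le => k nk.
by rewrite ler_pdivlMr// mulrC -modulusZ; exact: le_hat.
Qed.

Lemma hat_eq0 x : linfty x -> (forall n, hat x n = 0) -> x = 0.
Proof.
move=> dx h; apply: modulus_eq0 => n; apply/eqP.
by rewrite eq_le modulus_ge0 andbT -(h n); exact: le_hat.
Qed.

Definition ell : scale := @Scale setT modulus I (fun _ _ _ _ _ => I)
  modulus_ge0 (fun x y n _ _ => modulusD x y n) (fun a x n _ => modulusZ a x n)
  (fun x _ => @modulus_eq0 x).

Definition ces : scale := @Scale setT cesaro_modulus I (fun _ _ _ _ _ => I)
  cesaro_modulus_ge0 (fun x y n _ _ => cesaro_modulusD x y n)
  (fun a x n _ => cesaro_modulusZ a x n) (fun x _ => @cesaro_modulus_eq0 x).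

Definition dscale : scale :=
  @Scale linfty hat linfty0 linftyP hat_ge0 hatD hatZ hat_eq0.

End scales.
Arguments scale : clear implicits.

Section sequence_subspaces.
Context {R : realType}.
Local Notation omega := (nat -> R[i]).

Record linset := LinSet {
  linset_set : set omega;
  linset0 : linset_set 0;
  linsetP : forall a x y, linset_set x -> linset_set y -> linset_set (a *: x + y) }.

Definition linset_pred (S : linset) : {pred omega} :=
  fun x => x \in linset_set S.

Lemma linset_pred_closed S : submod_closed (linset_pred S).
Proof.
split; first by rewrite unfold_in; apply/mem_set; exact: linset0.
move=> a x y; rewrite !unfold_in !inE; exact: linsetP.
Qed.

HB.instance Definition _ S := GRing.isSubmodClosed.Build R[i] omega
  (linset_pred S) (linset_pred_closed S).

Record seqsub (S : linset) := SeqSub {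
  coords : omega;
  coordsP : coords \in linset_pred S }.

HB.instance Definition _ S := [isSub of seqsub S for @coords S].
HB.instance Definition _ S := [Choice of seqsub S by <:].
HB.instance Definition _ S := [SubChoice_isSubLmodule of seqsub S by <:].

End sequence_subspaces.
Arguments linset : clear implicits.

Section locally_convex.
Context {K : numFieldType} (E : lmodType K).

(* [c] makes the vector space E a locally convex topological vector space; this
   is the content of [PreTopologicalLmod_isTvs] for a topology which is not the
   canonical one of its carrier. *)
Definition lc_topology (c : Topological E) : Prop :=
  let T := Topological.Pack c in
  [/\ continuous (fun z : T * T => ((z.1 : E) + (z.2 : E) : T)),
      continuous (fun z : K^o * T => (z.1 *: (z.2 : E) : T)) &
      exists2 B : set (set T), (forall b, B b -> @convex_set K E b) & basis B].

Lemma convex_setI (A B : set E) :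
  @convex_set K E A -> @convex_set K E B -> @convex_set K E (A `&` B).
Proof.
move=> cA cB x y l; rewrite !in_setI => /andP[xA xB] /andP[yA yB].
by apply/andP; split; [exact: cA|exact: cB].
Qed.

End locally_convex.

(* The supremum of the set [P] of topologies on E.  The library's
   [sup_topology] cannot be used when [P] ranges over all topologies on E, for
   reasons of universe levels. *)
Definition topsup (E : choiceType) (P : Topological E -> Prop) : Type := E.

Section topsup.
Context {E : choiceType} (P : Topological E -> Prop).
Local Notation S := (topsup P).

Definition topsup_subbase : set (set E) :=
  [set U : set E | exists2 c, P c & @open (Topological.Pack c) U].

HB.instance Definition _ := Choice.on S.
HB.instance Definition _ := isSubBaseTopological.Build S topsup_subbase id.

Lemma cvg_topsup (F : set_system E) (x : E) : Filter F ->
  F --> (x : S) <-> forall c, P c -> F --> (x : Topological.Pack c).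
Proof.
move=> FF; split=> cvFx.
  move=> c Pc A /=; rewrite (@nbhsE (Topological.Pack c)) => -[B [oB Bx] BA].
  apply: cvFx; exists B; split=> //; exists [set B]; last first.
    by rewrite predeqE => ?; split=> [[_ ->]|] //; exists B.
  move=> _ ->; exists [fset B]%fset.
    by move=> ?; rewrite inE inE => /eqP->; exists c.
  by rewrite predeqE => ?; split=> [|??]; [apply|]; rewrite /= inE // => /eqP->.
move=> A /=; rewrite (@nbhsE S).
move=> [_ [[B sB <-] [C BC Cx] UBA]].
rewrite nbhs_filterE; apply: filterS UBA _; apply: (@filterS _ _ _ C).
  by move=> ? ?; exists C.
have /sB [D sD IDeC] := BC; rewrite -IDeC; apply: filter_bigI => G DG.
have /sD := DG; rewrite inE => -[c Pc]; rewrite openE => oG.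
by apply: (cvFx c Pc); apply: oG; move: Cx; rewrite -IDeC => /(_ _ DG).
Qed.

Lemma topsup_id c : P c -> continuous (idfun : S -> Topological.Pack c).
Proof.
by move=> Pc x; apply: (proj1 (cvg_topsup x (nbhs_filter (x : S)))).
Qed.

End topsup.

Section locally_convex_theory.
Context {K : numFieldType} (E : lmodType K).

Section sup.
Context (P : Topological E -> Prop).
Hypothesis P_lc : forall c, P c -> lc_topology c.
Let S : topologicalType := topsup P.

Lemma lc_topology_sup : lc_topology (Topological.class (topsup P)).
Proof.
split.
- move=> z; apply/cvg_topsup => c Pc; pose T := Topological.Pack c.
  have zc : (fun w : S * S => (w.1 : T, w.2 : T)) @ z --> (z : T * T).
    apply: cvg_pair.
      exact: (cvg_comp (@fst S S) (idfun : S -> T) cvg_fst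
        (@topsup_id _ P c Pc z.1)).
    exact: (cvg_comp (@snd S S) (idfun : S -> T) cvg_snd
      (@topsup_id _ P c Pc z.2)).
  have [addc _ _] := P_lc Pc; exact: (cvg_comp _ _ zc (addc z)).
- move=> z; apply/cvg_topsup => c Pc; pose T := Topological.Pack c.
  have zc : (fun w : K^o * S => (w.1, w.2 : T)) @ z --> (z : K^o * T).
    have z1 : (@fst K^o S) @ z --> z.1 by exact: cvg_fst.
    have z2 : (fun w : K^o * S => w.2 : T) @ z --> (z.2 : T).
      exact: (cvg_comp (@snd _ S) (idfun : S -> T) cvg_snd
        (@topsup_id _ P c Pc z.2)).
    exact: (cvg_pair z1 z2).
  have [_ scalec _] := P_lc Pc; exact: (cvg_comp _ _ zc (scalec z)).
- exists [set U : set S | open U /\ @convex_set K E U]; first by move=> b [].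
  split; first by move=> b [].
  move=> x; set F := filter_from _ _.
  have FF : Filter F.
    apply: filter_from_filter.
      by exists setT; split => //; split; [exact: openT|move=> ? ? ?; rewrite !inE].
    move=> A B [[oA cA] Ax] [[oB cB] Bx]; exists (A `&` B) => //.
    by split => //; split; [exact: openI|exact: convex_setI].
  apply/cvg_topsup => c Pc; pose T := Topological.Pack c.
  have [_ _ [B cB [oB Bx]]] := P_lc Pc.
  apply: cvg_trans (Bx x) => A [U [BU Ux] UA]; exists U => //.
  split => //; split; last exact: cB.
  by have /continuousP := topsup_id Pc; apply; exact: oB.
Qed.

End sup.

Lemma lc_topology_initial (V : tvsType K) (f : {linear E -> V}) :
  lc_topology (Topological.class (initial_topology f)).
Proof.
set W := initial_topology f.
have cf : continuous (f : W -> V) by exact: initial_continuous.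
have cvg_W (T : Type) (F : set_system T) (FF : Filter F) (g : T -> W) (x : W) :
    (fun t => f (g t)) @ F --> f x -> g @ F --> x.
  move=> Fx A [_ [[U oU <-] Ux] UA].
  exact: (filterS UA (Fx U (open_nbhs_nbhs (conj oU Ux)))).
split.
- move=> z; apply: (cvg_W _ _ (@nbhs_filter (W * W)%type z)).
  have -> : (fun w : W * W => f ((w.1 : E) + (w.2 : E))) =
      (fun w => f w.1 + f w.2) by apply/funext => w; rewrite linearD.
  have z1 : (fun w : W * W => f w.1) @ z --> f z.1.
    exact: (cvg_comp (@fst W W) (f : W -> V) cvg_fst (cf z.1)).
  have z2 : (fun w : W * W => f w.2) @ z --> f z.2.
    exact: (cvg_comp (@snd W W) (f : W -> V) cvg_snd (cf z.2)).
  rewrite linearD.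
  exact: (cvg_comp _ _ (cvg_pair z1 z2) (@add_continuous V (f z.1, f z.2))).
- move=> z; apply: (cvg_W _ _ (@nbhs_filter (K^o * W)%type z)).
  have -> : (fun w : K^o * W => f (w.1 *: (w.2 : E))) =
      (fun w => w.1 *: f w.2) by apply/funext => w; rewrite linearZ.
  have z1 : (@fst K^o W) @ z --> z.1 by exact: cvg_fst.
  have z2 : (fun w : K^o * W => f w.2) @ z --> f z.2.
    exact: (cvg_comp (@snd _ W) (f : W -> V) cvg_snd (cf z.2)).
  rewrite linearZ.
  exact: (cvg_comp _ _ (cvg_pair z1 z2)
    (@scale_continuous K V (z.1, f z.2))).
- have [B cB [oB Bx]] := @locally_convex K V.
  exists [set f @^-1` b | b in B].
    move=> _ [b Bb <-] x y l; rewrite !inE/= => bx by_.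
    have := cB b (mem_set Bb) (f x) (f y) l; rewrite !inE => /(_ bx by_).
    by rewrite /conv/= linearD !linearZ.
  split; first by move=> _ [b /oB ob <-]; exists b.
  move=> x A [_ [[U oU <-] Ux] UA].
  have [b [Bb bx] bU] := Bx (f x) U (open_nbhs_nbhs (conj oU Ux)).
  exists (f @^-1` b); first by split => //; exists b.
  by apply: subset_trans UA => y; exact: bU.
Qed.

End locally_convex_theory.

Definition lcsup (K : numFieldType) (E : lmodType K)
  (P : Topological E -> Prop) (P_lc : forall c, P c -> lc_topology c) : Type :=
  topsup P.

Section lcsup.
Context {K : numFieldType} (E : lmodType K).
Context (P : Topological E -> Prop) (P_lc : forall c, P c -> lc_topology c).
Local Notation S := (lcsup P_lc).

HB.instance Definition _ := GRing.Lmodule.copy S E.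
HB.instance Definition _ := Topological.copy S (topsup P).

Let addS : continuous (fun z : S * S => z.1 + z.2).
Proof. by have [] := lc_topology_sup P_lc. Qed.

Let scaleS : continuous (fun z : K^o * S => z.1 *: z.2).
Proof. by have [] := lc_topology_sup P_lc. Qed.

Let convexS : exists2 B : set_system S,
  (forall b, b \in B -> convex_set b) & basis B.
Proof.
have [_ _ [B cB bB]] := lc_topology_sup P_lc.
by exists B => // b /set_mem; exact: cB.
Qed.

HB.instance Definition _ :=
  PreTopologicalLmod_isTvs.Build K S addS scaleS convexS.
HB.instance Definition _ :=
  PreTopologicalNmodule_isTopologicalNmodule.Build S addS.
HB.instance Definition _ :=
  TopologicalNmodule_isTopologicalLmodule.Build K S scaleS.
HB.instance Definition _ := Uniform_isTvs.Build K S convexS.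

End lcsup.

Section inclusions.
Context {R : realType}.
Implicit Types S T : linset R.

Definition incl S T (ST : linset_set S `<=` linset_set T) (x : seqsub S) :
  seqsub T := SeqSub (mem_set (ST _ (set_mem (coordsP x)))).

Lemma coords_linear S : linear (@coords R S).
Proof. by []. Qed.

HB.instance Definition _ S := GRing.isLinear.Build R[i] (seqsub S)
  (nat -> R[i]) _ (@coords R S) (@coords_linear S).

Lemma coords_inj S : injective (@coords R S).
Proof. exact: val_inj. Qed.

Lemma incl_linear S T (ST : linset_set S `<=` linset_set T) : linear (incl ST).
Proof. by move=> a x y; apply: coords_inj. Qed.

HB.instance Definition _ S T (ST : linset_set S `<=` linset_set T) :=
  GRing.isLinear.Build R[i] (seqsub S) (seqsub T) _ (incl ST) (incl_linear ST).

End inclusions.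

Section Banach.
Context {R : realType} (S : scale R) (q : R) (q1 : 1 <= q).
Local Notation omega := (nat -> R[i]).

Definition scale_set : set omega :=
  [set x | dom S x /\ (lqnorm q (maj S x) < +oo)%E].

Let q0 : 0 < q. Proof. exact: lt_le_trans q1. Qed.

Let norm_maj x n : `|maj S x n| = maj S x n.
Proof. by rewrite ger0_norm// maj_ge0. Qed.

Let scale_normZ (a : R[i]) x : dom S x ->
  lqnorm q (maj S (a *: x)) = ((normc a)%:E * lqnorm q (maj S x))%E.
Proof.
move=> dx; rewrite -[in RHS](ger0_norm (normc_ge0 a)) -lqnormZ//.
by congr lqnorm; apply/funext => n; rewrite majZ.
Qed.

Let scale_normD x y : dom S x -> dom S y ->
  (lqnorm q (maj S (x + y)%R) <= lqnorm q (maj S x) + lqnorm q (maj S y))%E.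
Proof.
move=> dx dy; apply: le_trans (lqnormD _ _ q1); apply: lqnorm_le => // n.
by rewrite norm_maj ger0_norm ?addr_ge0 ?maj_ge0// majD.
Qed.

Let domZ (a : R[i]) x : dom S x -> dom S (a *: x).
Proof. by move=> dx; rewrite -[_ *: _]addr0; apply: domP => //; exact: dom0. Qed.

Lemma scale_set0 : scale_set 0.
Proof.
split; first exact: dom0.
by rewrite -(scale0r 0) scale_normZ ?normc0 ?mul0e//; exact: dom0.
Qed.

Lemma scale_setP a x y : scale_set x -> scale_set y -> scale_set (a *: x + y).
Proof.
move=> [dx xoo] [dy yoo]; split; first exact: domP.
apply: le_lt_trans (scale_normD (domZ a dx) dy) _.
rewrite scale_normZ//; apply: lte_add_pinfty => //.
by rewrite lte_mul_pinfty// lee_fin normc_ge0.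
Qed.

Definition scale_linset : linset R := LinSet scale_set0 scale_setP.

Definition scale_norm (x : omega) : R := fine (lqnorm q (maj S x)).

Definition banach : Type := seqsub scale_linset.

HB.instance Definition _ := GRing.Lmodule.on banach.

Let coords_set (x : banach) : scale_set (coords x).
Proof. exact: set_mem (coordsP x). Qed.

Let fin (x : banach) : lqnorm q (maj S (coords x)) \is a fin_num.
Proof. by rewrite ge0_fin_numE ?lqnorm_ge0//; case: (coords_set x). Qed.

Let norm (x : banach) : R[i] := (scale_norm (coords x))%:C%C.

Let ler_normD (x y : banach) : norm (x + y) <= norm x + norm y.
Proof.
rewrite /norm -rmorphD lecR /scale_norm -fineD ?fin// fine_le ?fin//.
  by rewrite fin_numD !fin.
by apply: scale_normD; [case: (coords_set x)|case: (coords_set y)].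
Qed.

Let normrZ (a : R[i]) (x : banach) : norm (a *: x) = `|a| * norm x.
Proof.
have [dx _] := coords_set x.
rewrite /norm normr_normc -rmorphM; congr _%:C%C.
by rewrite /scale_norm scale_normZ// fineM// fin.
Qed.

Let normr0_eq0 (x : banach) : norm x = 0 -> x = 0.
Proof.
move=> /(congr1 (@complex.Re R))/= /eqP; rewrite fine_eq0 ?fin// => /eqP x0.
have [dx _] := coords_set x.
apply: coords_inj; apply: (maj_eq0 dx) => n; apply/eqP.
rewrite -normr_eq0 -eqe eq_le; apply/andP; split; last by rewrite lee_fin.
by rewrite -[leRHS]x0 lqnorm_ge.
Qed.

HB.instance Definition _ :=
  Lmodule_isNormed.Build R[i] banach ler_normD normrZ normr0_eq0.

End Banach.

Section Frechet.
Context {R : realType} (S : scale R) (qs : nat -> R).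
Hypothesis qs1 : forall k, 1 <= qs k.

Definition frechet_set : set (nat -> R[i]) := \bigcap_k scale_set S (qs k).

Lemma frechet_set0 : frechet_set 0.
Proof. by move=> k _; exact: scale_set0. Qed.

Lemma frechet_setP a x y :
  frechet_set x -> frechet_set y -> frechet_set (a *: x + y).
Proof.
by move=> xS yS k _; apply: scale_setP => //; [exact: xS|exact: yS].
Qed.

Definition frechet_linset : linset R := LinSet frechet_set0 frechet_setP.

Lemma frechet_sub k :
  linset_set frechet_linset `<=` linset_set (scale_linset S (qs1 k)).
Proof. by move=> x; exact. Qed.

Definition frechet_incl k : {linear seqsub frechet_linset -> banach S (qs1 k)} :=
  incl (@frechet_sub k).

Definition frechet_topology (c : Topological (seqsub frechet_linset)) : Prop :=
  exists k, c = Topological.class (initial_topology (frechet_incl k)).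

Lemma frechet_topology_lc c : frechet_topology c -> lc_topology c.
Proof. by move=> [k ->]; exact: lc_topology_initial. Qed.

(* The topology generated by the norms: the coarsest one for which all the
   inclusions into the Banach spaces are continuous. *)
Definition frechet : Type := lcsup frechet_topology_lc.

HB.instance Definition _ := Tvs.copy frechet (lcsup frechet_topology_lc).

End Frechet.

Section LB.
Context {R : realType} (S : scale R) (qs : nat -> R).
Hypotheses (qs1 : forall k, 1 <= qs k) (incr_qs : increasing_seq qs).

Definition lb_set : set (nat -> R[i]) := \bigcup_k scale_set S (qs k).

Lemma scale_set_mono (q r : R) : 1 <= q -> q <= r ->
  scale_set S q `<=` scale_set S r.
Proof.
move=> q1 qr x [dx xq]; split=> //; apply: lqnorm_mono xq => //.
exact: lt_le_trans q1.
Qed.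

Lemma lb_set0 : lb_set 0.
Proof. by exists 0%N => //; exact: scale_set0. Qed.

Lemma lb_setP a x y : lb_set x -> lb_set y -> lb_set (a *: x + y).
Proof.
move=> [k _ xk] [m _ ym]; exists (maxn k m) => //; apply: scale_setP => //.
  by apply: scale_set_mono xk => //; rewrite incr_qs leq_maxl.
by apply: scale_set_mono ym => //; rewrite incr_qs leq_maxr.
Qed.

Definition lb_linset : linset R := LinSet lb_set0 lb_setP.

Lemma lb_sub k :
  linset_set (scale_linset S (qs1 k)) `<=` linset_set lb_linset.
Proof. by move=> x xk; exists k. Qed.

Definition lb_incl k : {linear banach S (qs1 k) -> seqsub lb_linset} :=
  incl (@lb_sub k).

Definition lb_admissible (c : Topological (seqsub lb_linset)) : Prop :=
  lc_topology c /\
  forall k, continuous (lb_incl k : banach S (qs1 k) -> Topological.Pack c).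

Lemma lb_admissible_lc c : lb_admissible c -> lc_topology c.
Proof. by case. Qed.

(* The finest locally convex topology making all the inclusions continuous,
   obtained as the supremum of all locally convex topologies that do so *)
Definition lb : Type := lcsup lb_admissible_lc.

HB.instance Definition _ := Tvs.copy lb (lcsup lb_admissible_lc).

(* The topology of [lb] is itself admissible, hence the finest admissible one. *)
Lemma lb_incl_continuous k : continuous (lb_incl k : banach S (qs1 k) -> lb).
Proof.
move=> x; have xF : Filter (lb_incl k @ x).
  exact: (@fmap_filter _ _ (lb_incl k) (nbhs x) (nbhs_filter x)).
by apply: (proj2 (@cvg_topsup _ lb_admissible _ _ xF)) => c [_]; exact.
Qed.

Lemma lb_finest c : lb_admissible c ->
  continuous (idfun : lb -> Topological.Pack c).
Proof. exact: topsup_id. Qed.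

End LB.

Section operators.
Context {K : numFieldType} {E : tvsType K}.
Implicit Types T : E -> E.

Definition tvs_bounded : set (set E) :=
  [set B | forall U, nbhs (0 : E) U ->
    exists2 r : K, 0 < r & B `<=` [set r *: u | u in U]].

(* Equicontinuity of {T^n : n >= 1}, that is, the library's [equicontinuous]
   without its requirement that the type be pointed. *)
Definition power_bounded T : Prop :=
  forall (x : E) (V : set (E * E)), entourage V ->
    \forall y \near x, forall n, (0 < n)%N -> V (iter n T x, iter n T y).

Definition ergodic_mean T (n : nat) : E -> E :=
  fun x => n%:R^-1 *: \sum_(1 <= m < n.+1) iter m T x.

Definition uniformly_mean_ergodic T : Prop :=
  exists P : {linear E -> E}, continuous P /\
    {family tvs_bounded, ergodic_mean T @ \oo --> (P : E -> E)}.

Definition supercyclic T : Prop :=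
  exists x, dense [set y | exists (l : K) (n : nat), y = l *: iter n T x].

End operators.

Section spaces.
Context {R : realType}.

(* A locally convex sequence space, [seq_coords] being the inclusion into the
   space of all sequences. *)
Record seq_space := SeqSpace {
  seq_tvs :> tvsType R[i];
  seq_coords : seq_tvs -> nat -> R[i] }.

Definition banach_space (S : scale R) q (q1 : 1 <= q) : seq_space :=
  @SeqSpace (banach S q1) (@coords R _).

Definition frechet_space (S : scale R) qs (qs1 : forall k, 1 <= qs k) : seq_space :=
  @SeqSpace (frechet S qs1) (@coords R _).

Definition lb_space (S : scale R) qs (qs1 : forall k, 1 <= qs k)
    (incr_qs : increasing_seq qs) : seq_space :=
  @SeqSpace (lb S qs1 incr_qs) (@coords R _).

Definition frechet_exponents (p : R) (qs : nat -> R) : Prop :=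
  [/\ forall k, p < qs k, decreasing_seq qs & qs @ \oo --> p].

Definition lb_exponents (p : \bar R) (qs : nat -> R) : Prop :=
  [/\ forall k, 1 < qs k, forall k, ((qs k)%:E < p)%E &
      (EFin \o qs) @ \oo --> p].

(* The hypotheses [qs1] below are consequences of the other ones. *)
Inductive cesaro_space : seq_space -> Prop :=
| Space_d p (p1 : 1 <= p) : cesaro_space (banach_space dscale p1)
| Space_ell p (p1 : 1 <= p) : cesaro_space (banach_space ell p1)
| Space_ces p (p1 : 1 < p) : cesaro_space (banach_space ces (ltW p1))
| Space_ell_plus p qs (qs1 : forall k, 1 <= qs k) :
    1 <= p -> frechet_exponents p qs -> cesaro_space (frechet_space ell qs1)
| Space_ces_plus p qs (qs1 : forall k, 1 <= qs k) :
    1 <= p -> frechet_exponents p qs -> cesaro_space (frechet_space ces qs1)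
| Space_d_plus p qs (qs1 : forall k, 1 <= qs k) :
    1 <= p -> frechet_exponents p qs -> cesaro_space (frechet_space dscale qs1)
| Space_ell_minus p qs (qs1 : forall k, 1 <= qs k) (incr_qs : increasing_seq qs) :
    (1 < p)%E -> lb_exponents p qs -> cesaro_space (lb_space ell qs1 incr_qs)
| Space_ces_minus p qs (qs1 : forall k, 1 <= qs k) (incr_qs : increasing_seq qs) :
    (1 < p)%E -> lb_exponents p qs -> cesaro_space (lb_space ces qs1 incr_qs)
| Space_d_minus p qs (qs1 : forall k, 1 <= qs k) (incr_qs : increasing_seq qs) :
    (1 < p)%E -> lb_exponents p qs -> cesaro_space (lb_space dscale qs1 incr_qs).

End spaces.
Arguments seq_space : clear implicits.

(* Main.v *)
(** Let [G] be convolution with [(t^k)], so [G x n = t * G x n.-1 + x n] and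
    [C_t x n = G x n / n.+1].  Induction gives [C_t (G |x|) <= G |x|], hence
    [|C_t^m x| <= G |x|] for every [m], whereas [G] is bounded on each of the
    Banach spaces, uniformly in the exponent.
    The fixed vectors of [C_t] are the multiples of [(t^k)]; put
    [P x = (x_0 t^k)].  On [x_0 = 0] the operator [1 - C_t] has the explicit
    inverse [x |-> x + G (x_k / k)], whence
    [n (T_[n] - P) x = C_t w - C_t^(n+1) w] with [|w| <= 4 G (G |x|)].
    Thus the [C_t^m] and the [n (T_[n] - P)] all belong to one family of
    operators dominated by [8 G^3], and such a family is equicontinuous on
    every space considered.  On the inductive limits equicontinuity is enough,
    because a bounded set is absorbed by every neighborhood of [0].
    Finally, [x_0] and [x_1 - t x_0] are eigenfunctionals of [C_t] for the
    eigenvalues [1] and [1/2], so [|x_1 - t x_0| / |x_0|] does not increase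
    along an orbit, which rules out supercyclicity. *)

Require Import Defs.
From HB Require Import structures.
From mathcomp Require Import all_boot all_order all_algebra.
From mathcomp Require Import all_classical all_reals all_analysis.
From mathcomp Require Import complex.
From mathcomp Require Import ring lra.

Set Implicit Arguments.
Unset Strict Implicit.
Unset Printing Implicit Defensive.
Import Order.TTheory GRing.Theory Num.Theory.
Import numFieldNormedType.Exports.

Local Open Scope classical_set_scope.
Local Open Scope ring_scope.

(** * Convolution with the powers of [t], pointwise *)

Fixpoint geo (K : pzRingType) (t : K) (a : nat -> K) (n : nat) : K :=
  if n is m.+1 then t * geo t a m + a n else a 0%N.

Lemma cesaro_opE (K : fieldType) (t : K) (x : nat -> K) n :
  cesaro_op t x n = geo t x n / n.+1%:R.
Proof.
rewrite /cesaro_op; congr (_ / _); elim: n => [|n IH].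
  by rewrite big_ord1 subnn mul1r.
rewrite big_ord_recr/= subnn mul1r -IH mulr_sumr; congr (_ + _).
by apply: eq_bigr => k _; rewrite subSn ?exprS ?mulrA// -ltnS.
Qed.

Lemma geo_linear (K : comPzRingType) (t c : K) (a b : nat -> K) n :
  geo t (fun k => c * a k + b k) n = c * geo t a n + geo t b n.
Proof. by elim: n => [//|n IH] /=; rewrite IH !mulrDr mulrCA addrACA. Qed.

Lemma geoZ (K : comPzRingType) (t c : K) (a : nat -> K) n :
  geo t (fun k => c * a k) n = c * geo t a n.
Proof. by elim: n => [//|n IH] /=; rewrite IH mulrDr mulrCA. Qed.

Section geo_order.
Context {R : realType} (t : R) (t0 : 0 <= t).
Implicit Types a b : nat -> R.

Lemma geo_le a b : (forall n, a n <= b n) -> forall n, geo t a n <= geo t b n.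
Proof. by move=> ab; elim=> [|n IH] //=; rewrite lerD// ler_wpM2l. Qed.

Lemma geo_ge0 a : (forall n, 0 <= a n) -> forall n, 0 <= geo t a n.
Proof. by move=> a0; elim=> [|n IH] //=; rewrite addr_ge0// mulr_ge0. Qed.

Lemma le_geo a : (forall n, 0 <= a n) -> forall n, a n <= geo t a n.
Proof. by move=> a0 [|n] //=; rewrite lerDr mulr_ge0 ?geo_ge0. Qed.

(** Divided by [n.+1], this says that the Cesaro operator maps [geo t a] below itself. The induction
    rests on [t * geo t a n <= geo t a n.+1]. *)
Lemma geo_geo_le a : (forall n, 0 <= a n) ->
  forall n, geo t (geo t a) n <= n.+1%:R * geo t a n.
Proof.
move=> a0; elim=> [|n IH]; first by rewrite mul1r.
rewrite -[n.+2]addn1 natrD mulrDl mul1r -[leLHS]/(t * _ + geo t a n.+1).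
rewrite lerD2r; apply: le_trans (ler_wpM2l t0 IH) _.
by rewrite mulrCA ler_wpM2l//= lerDl.
Qed.

End geo_order.

(** * Powers, fixed vectors and resolvent of the Cesaro operator *)

Section cesaro_powers.
Context {R : realType} (t : R) (t01 : 0 <= t < 1).
Local Notation omega := (nat -> R[i]).
Local Notation tC := (t%:C)%C.
Implicit Types x y : omega.

Let t0 : 0 <= t. Proof. by case/andP: t01. Qed.

Lemma normc_real (r : R) : 0 <= r -> normc (r%:C)%C = r.
Proof.
by move=> r0; rewrite /= expr0n addr0 sqrtr_sqr ger0_norm.
Qed.

Lemma normc_inv_nat n : normc (n%:R^-1 : R[i]) = n%:R^-1.
Proof. by rewrite -(rmorph_nat (real_complex R)) -fmorphV normc_real. Qed.

Lemma modulus_geo x n : modulus (geo tC x) n <= geo t (modulus x) n.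
Proof.
elim: n => [//|n IH]; rewrite /modulus/=; apply: le_trans (normcD _ _) _.
by rewrite lerD2r normcZ normc_real// ler_wpM2l.
Qed.

Lemma modulus_cesaro x n :
  modulus (cesaro_op tC x) n <= geo t (modulus x) n / n.+1%:R.
Proof.
rewrite /modulus cesaro_opE normcZ normc_inv_nat.
by rewrite ler_wpM2r ?invr_ge0//; exact: modulus_geo.
Qed.

Lemma modulus_iter_cesaro m x n :
  modulus (iter m (cesaro_op tC) x) n <= geo t (modulus x) n.
Proof.
have x0 k : 0 <= modulus x k by exact: modulus_ge0.
elim: m n => [|m IH] n; first exact: le_geo.
apply: le_trans (modulus_cesaro _ _) _.
rewrite ler_pdivrMr// mulrC; apply: le_trans (geo_geo_le t0 x0 n).
exact: geo_le.
Qed.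

Lemma cesaro_op_linear : linear (cesaro_op tC).
Proof.
move=> a x y; apply/funext => n; rewrite cesaro_opE geo_linear mulrDl -mulrA.
by rewrite addrfctE scalrfctE !cesaro_opE.
Qed.

Definition cesaro_proj x : omega := fun n => x 0%N * tC ^+ n.

(* The inverse of 1 - C_t on the sequences with x_0 = 0, for which the junk
   value x_0 / 0 = 0 of the first summand is harmless. *)
Definition cesaro_resolvent x : omega :=
  x + geo tC (fun k => x k / k%:R).

Lemma cesaro_proj_linear : linear cesaro_proj.
Proof.
move=> a x y; apply/funext => n.
by rewrite /cesaro_proj addrfctE scalrfctE mulrDl -mulrA.
Qed.

(** Multiplied by [n.+1], the claim is that the convolution of [(t^k)] with itself is
    [(n+1) t^n]. *)
Lemma cesaro_proj_fix x : cesaro_op tC (cesaro_proj x) = cesaro_proj x.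
Proof.
apply/funext => n; rewrite cesaro_opE /cesaro_proj.
apply: (canLR (mulfK _)); first by rewrite pnatr_eq0.
elim: n => [|n IH]; first by rewrite mulr1.
by rewrite /= IH exprS -[n.+2]addn1 natrD; ring.
Qed.

(** With [u] the convolution of [x_k / k], it suffices that the operator sends [x + u] to [u], that
    is [geo (x + u) n = (n+1) u_n]; the recursion for [u] makes this an induction. *)
Lemma cesaro_resolventP x : x 0%N = 0 ->
  cesaro_resolvent x - cesaro_op tC (cesaro_resolvent x) = x.
Proof.
move=> x0; rewrite /cesaro_resolvent; set u := geo tC _.
suff -> : cesaro_op tC (x + u) = u by rewrite addrK.
apply/funext => n; rewrite cesaro_opE.
apply: (canLR (mulfK _)); first by rewrite pnatr_eq0.
elim: n => [|n IH].
  (* Here [x 0 = 0] enters; the term [x 0 / 0] of [u] is zero as well. *)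
  by rewrite /= addrfctE x0 /u /= mulr0n x0 mul0r addr0 mul0r.
have n0 : n.+1%:R != 0 :> R[i] by rewrite pnatr_eq0.
have uS : u n.+1 = tC * u n + x n.+1 / n.+1%:R by [].
rewrite /= IH addrfctE uS -[n.+2]addn1 natrD.
by field.
Qed.

End cesaro_powers.

(** * Boundedness of the convolution on [l^q] *)

Section geo_lq.
Context {R : realType} (t : R) (t01 : 0 <= t < 1).
Implicit Types (a b : nat -> R) (q r : R).

Let t0 : 0 <= t. Proof. by case/andP: t01. Qed.
Let t1 : 0 < 1 - t. Proof. by case/andP: t01; rewrite subr_gt0. Qed.


Let series_ge0 q a n : (0 <= (`|a n| `^ q)%:E)%E.
Proof. by rewrite lee_fin powR_ge0. Qed.

Lemma poweR_lqnorm q a : 0 < q ->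
  (lqnorm q a `^ q = \sum_(k <oo) (`|a k| `^ q)%:E)%E.
Proof.
move=> q0; rewrite lqnormE// -poweRrM mulVf ?gt_eqF// poweRe1//.
exact: nneseries_ge0.
Qed.

Lemma lqnorm_shift q a : 0 < q ->
  (lqnorm q (fun n => if n is m.+1 then a m else 0%R) = lqnorm q a)%E.
Proof.
move=> q0; set b := (fun n => _); rewrite !lqnormE//; congr (_ `^ _)%E.
rewrite [LHS](nneseries_recl (fun n _ => series_ge0 q b n))// -nneseries_addn//.
rewrite /= normr0 powR0 ?gt_eqF// add0e.
by apply: eq_eseriesr => n _; rewrite addn1.
Qed.

(** Partial sums of the series are [q]-th powers of norms of truncations. Estimates can thus be
    proved on truncations, whose norms are finite. *)
Lemma lqnorm_le_trunc q a (M : \bar R) : 0 < q ->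
  (forall N, lqnorm q (fun n => if (n < N)%N then a n else 0)%R <= M)%E ->
  (lqnorm q a <= M)%E.
Proof.
move=> q0 aM; have M0 : (0 <= M)%E by apply: le_trans (aM 0%N); exact: lqnorm_ge0.
rewrite -[leRHS]poweRe1// -(mulfV (lt0r_neq0 q0)) poweRrM lqnormE//.
apply: gt0_ler_poweR; rewrite ?invr_ge0 ?(ltW q0)// ?in_itv/= ?leey ?poweR_ge0//.
  by rewrite andbT nneseries_ge0.
apply: lime_le; first by apply: is_cvg_nneseries => n _ _.
apply: nearW => N.
have := gt0_ler_poweR (ltW q0) _ _ (aM N).
rewrite !in_itv/= !leey !andbT lqnorm_ge0 M0 => /(_ isT isT).
apply: le_trans; rewrite poweR_lqnorm//.
apply: le_trans (nneseries_lim_ge N _); last by [].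
rewrite !big_mkord; apply: lee_sum => k _; by rewrite ltn_ord.
Qed.

Lemma lqnorm_trunc_lty q a N : 0 < q ->
  (lqnorm q (fun n => if (n < N)%N then a n else 0)%R < +oo)%E.
Proof.
move=> q0; rewrite lqnorm_ltyE// (nneseries_split 0 N); last by [].
rewrite eseries0 ?adde0; last first.
  by move=> i Ni _; rewrite ltnNge Ni/= normr0 powR0// gt_eqF.
by rewrite sumEFin ltry.
Qed.

(** A truncation [v] of [geo t a] satisfies [v <= t * shift v + a] pointwise, so its norm is at most
    [t] times itself plus the norm of [a] by Minkowski's inequality; being finite, it can be
    subtracted. *)
Lemma lqnorm_geo q a : 1 <= q -> (forall n, 0 <= a n) ->
  (lqnorm q (geo t a) <= ((1 - t)^-1)%:E * lqnorm q a)%E.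
Proof.
move=> q1 a0; have q0 : 0 < q by exact: lt_le_trans q1.
apply: lqnorm_le_trunc => // N; set v := (fun n => _).
have voo : lqnorm q v \is a fin_num.
  by rewrite ge0_fin_numE ?lqnorm_ge0 ?lqnorm_trunc_lty.
have v0 n : 0 <= v n by rewrite /v; case: ifP => // _; exact: geo_ge0.
pose sv := (fun n => if n is m.+1 then v m else 0%R).
have vle : (lqnorm q v <= t%:E * lqnorm q v + lqnorm q a)%E.
  rewrite -{2}(lqnorm_shift v q0) -/sv -[t in t%:E](ger0_norm t0) -lqnormZ//.
  apply: le_trans (lqnormD _ _ q1); apply: lqnorm_le => // n.
  have sv0 : 0 <= sv n by case: n.
  rewrite !ger0_norm ?addr_ge0 ?mulr_ge0//.
  case: n {sv0} => [|n]; rewrite /v /sv/=.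
    by rewrite mulr0 add0r; case: ifP.
  case: ifP => nN; last by rewrite addr_ge0 ?mulr_ge0.
  by rewrite /v ltnW.
have [->|aoo] := eqVneq (lqnorm q a) +oo%E.
  by rewrite gt0_muley ?leey// lte_fin invr_gt0.
have {}aoo : lqnorm q a \is a fin_num.
  by rewrite ge0_fin_numE ?lqnorm_ge0// lt_neqAle aoo leey.
move: vle; rewrite -(fineK voo) -(fineK aoo) -!EFinM -EFinD !lee_fin.
rewrite ler_pdivlMl//; lra.
Qed.

End geo_lq.

(** * The convolution on the three scales *)

Section geo_scales.
Context {R : realType} (t : R) (t01 : 0 <= t < 1).
Local Notation omega := (nat -> R[i]).
Implicit Types (x y : omega) (S : scale R) (a : nat -> R).

Let t0 : 0 <= t. Proof. by case/andP: t01. Qed.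
Let t1 : 0 < 1 - t. Proof. by case/andP: t01; rewrite subr_gt0. Qed.
Let c1 : 1 <= (1 - t)^-1. Proof. by rewrite invf_ge1// gerBl. Qed.
Let c0 : 0 <= (1 - t)^-1. Proof. by apply: le_trans c1. Qed.

(** [y] is any sequence below the convolution, so the bound can be iterated and applies to operators
    known only through a pointwise estimate. *)
Definition geo_bounded S (c : R) := forall q x y, 1 <= q -> scale_set S q x ->
  (forall n, modulus y n <= geo t (modulus x) n) ->
  dom S y /\ (lqnorm q (maj S y) <= c%:E * lqnorm q (maj S x))%E.

(** The recursion for [geo], summed over [k <= n]. For nonnegative [a] it bounds [(1 - t)] times the
    sums of [geo t a] by those of [a], which controls Cesaro means. *)
Lemma geo_sum a n :
  (1 - t) * (\sum_(k < n.+1) geo t a k) + t * geo t a n = \sum_(k < n.+1) a k.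
Proof.
elim: n => [|n IH]; first by rewrite !big_ord1/=; ring.
by rewrite big_ord_recr [RHS]big_ord_recr/= -IH; ring.
Qed.

(** [M / (1 - t)] is the fixed point of [s -> t s + M], so the recursion with data at most [M], once
    below it, stays below. *)
Lemma geo_le_bound a n M : 0 <= M -> (forall k, (n < k)%N -> a k <= M) ->
  geo t a n <= M / (1 - t) ->
  forall k, (n <= k)%N -> geo t a k <= M / (1 - t).
Proof.
move=> M0 aM an; elim=> [|k IH]; first by rewrite leqn0 => /eqP n0; rewrite -n0.
rewrite leq_eqVlt => /predU1P[<-//|nk] /=.
have {}IH := IH nk; apply: le_trans (lerD (ler_wpM2l t0 IH) (aM _ nk)) _.
rewrite le_eqVlt; apply/orP; left; apply/eqP; field.
by rewrite gt_eqF.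
Qed.

Let le_lqnormZ q a b : 1 <= q -> (forall n, 0 <= a n) ->
  (forall n, a n <= (1 - t)^-1 * b n) ->
  (lqnorm q a <= ((1 - t)^-1)%:E * lqnorm q b)%E.
Proof.
move=> q1 a0 ab; rewrite -[(1 - t)^-1 in leRHS]ger0_norm// -lqnormZ//.
apply: lqnorm_le => [|n]; first exact: lt_le_trans q1.
by rewrite !ger0_norm// (le_trans (a0 n)).
Qed.

Lemma geo_bounded_ell : geo_bounded ell (1 - t)^-1.
Proof.
move=> q x y q1 _ xy; split => //=.
apply: le_trans (lqnorm_geo t01 q1 (modulus_ge0 x)).
apply: lqnorm_le => [|n]; first exact: lt_le_trans q1.
by rewrite !ger0_norm ?modulus_ge0// geo_ge0// => k; exact: modulus_ge0.
Qed.

Lemma geo_bounded_ces : geo_bounded ces (1 - t)^-1.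
Proof.
move=> q x y q1 _ xy; split => //=; apply: le_lqnormZ => // n.
  exact: cesaro_modulus_ge0.
rewrite !cesaro_modulusE mulrA ler_wpM2r ?invr_ge0//.
rewrite ler_pdivlMl// -(geo_sum (modulus x)) ler_wpDr//.
  by rewrite mulr_ge0// geo_ge0// => k; exact: modulus_ge0.
by apply: ler_wpM2l; [exact: ltW|apply: ler_sum => k _; exact: xy].
Qed.

(** The supremum over [k >= n] costs one factor [1 / (1 - t)], as the recursion is started at [n]
    with data below [geo t (hat x) n]; the [l^q] bound for [geo t (hat x)] costs the other. *)
Lemma geo_bounded_d : geo_bounded Defs.dscale ((1 - t)^-1 * (1 - t)^-1).
Proof.
move=> q x y q1 [xoo _] xy.
have x0 k : 0 <= modulus x k by exact: modulus_ge0.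
have h0 k : 0 <= hat x k by exact: hat_ge0.
have yh n k : (n <= k)%N -> modulus y k <= (1 - t)^-1 * geo t (hat x) n.
  move=> nk; apply: le_trans (xy k) _; rewrite mulrC.
  have gx m : geo t (modulus x) m <= geo t (hat x) m.
    by apply: geo_le => // j; exact: le_hat.
  apply: geo_le_bound nk; first exact: geo_ge0.
    move=> j nj; apply: le_trans (le_geo t0 h0 n).
    by apply: le_hat => //; exact: ltnW.
  apply: le_trans (gx n) _; rewrite ler_peMr//; exact: geo_ge0.
have yoo : linfty y by exists ((1 - t)^-1 * geo t (hat x) 0%N) => n; exact: yh.
split => //=; rewrite EFinM -muleA.
apply: (@le_trans _ _ (((1 - t)^-1)%:E * lqnorm q (geo t (hat x)))%E).
  by apply: le_lqnormZ => // n; [exact: hat_ge0|apply: hat_le => k; exact: yh].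
by rewrite lee_wpmul2l ?lee_fin//; exact: lqnorm_geo.
Qed.

End geo_scales.

Lemma modulusN (R : realType) (x : nat -> R[i]) n : modulus (- x) n = modulus x n.
Proof. by rewrite /modulus -[LHS]/(normc (- x n)) normcN. Qed.

Lemma linear_funZ (K : pzRingType) (U V : lmodType K) (f : U -> V) a x :
  linear f -> f (a *: x) = a *: f x.
Proof.
move=> linf; have f0 : f 0 = 0.
  by have := linf (-1) 0 0; rewrite !scaleN1r !addNr.
by have := linf a x 0; rewrite f0 !addr0.
Qed.

(** * Operators dominated by the threefold convolution *)

Section dominated.
Context {R : realType} (t : R) (t01 : 0 <= t < 1).
Local Notation omega := (nat -> R[i]).
Local Notation tC := (t%:C)%C.
Local Notation C := (cesaro_op tC).
Implicit Types (x y : omega) (D : omega -> omega).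

Let t0 : 0 <= t. Proof. by case/andP: t01. Qed.

(** One convolution each accounts for [1 - P], for the resolvent and for the powers of the Cesaro
    operator. *)
Definition geo3 x : nat -> R := geo t (geo t (geo t (modulus x))).

(* The bound is the one that n (T_[n] - P) satisfies; see dominated_defect. *)
Definition dominated D :=
  linear D /\ forall x n, modulus (D x) n <= 8 * geo3 x n.

Let x0 x n : 0 <= modulus x n. Proof. exact: modulus_ge0. Qed.
Let gx0 x n : 0 <= geo t (modulus x) n. Proof. exact: geo_ge0. Qed.
Let ggx0 x n : 0 <= geo t (geo t (modulus x)) n. Proof. exact: geo_ge0. Qed.

Lemma geo_le_geo3 x n : geo t (modulus x) n <= geo3 x n.
Proof. by apply: le_trans (le_geo t0 (gx0 x) n) _; exact: le_geo. Qed.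

Lemma dominated_geo D : linear D ->
  (forall x n, modulus (D x) n <= geo t (modulus x) n) -> dominated D.
Proof.
move=> linD DG; split => // x n; apply: le_trans (DG x n) _.
apply: le_trans (geo_le_geo3 x n) _; rewrite ler_peMl ?ler1n//.
exact: geo_ge0.
Qed.

Lemma iter_cesaro_linear m : linear (iter m C).
Proof. by elim: m => [//|m IH] a x y; rewrite !iterS IH cesaro_op_linear. Qed.

Lemma dominated_iter m : dominated (iter m C).
Proof.
apply: dominated_geo; first exact: iter_cesaro_linear.
by move=> x n; exact: modulus_iter_cesaro.
Qed.

Lemma modulus_cesaro_proj x n : modulus (cesaro_proj t x) n <= geo t (modulus x) n.
Proof.
have -> : modulus (cesaro_proj t x) n = t ^+ n * modulus x 0%N.
  by rewrite /modulus normcZ mulrC -rmorphXn normc_real// exprn_ge0.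
elim: n => [|n IH]; first by rewrite expr0 mul1r.
by rewrite exprS -mulrA ler_wpDr// ler_wpM2l.
Qed.

Lemma dominated_proj : dominated (cesaro_proj t).
Proof.
by apply: dominated_geo; [exact: cesaro_proj_linear|exact: modulus_cesaro_proj].
Qed.

(** Absorbs the factor [r / n] in mean ergodicity, and provides the circled sets required in the
    inductive limits. *)
Lemma dominatedZ (a : R[i]) D : normc a <= 1 -> dominated D ->
  dominated (fun x => a *: D x).
Proof.
move=> a1 [linD DG]; split.
  by move=> b x y; rewrite linD scalerDr !scalerA mulrC.
move=> x n; rewrite modulusZ; apply: le_trans (DG x n).
by rewrite ler_piMl.
Qed.

Lemma cesaro_resolvent_linear : linear (cesaro_resolvent t).
Proof.
move=> a x y; apply/funext => n.
rewrite /cesaro_resolvent !addrfctE !scalrfctE scalerDr addrACA; congr (_ + _).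
rewrite -[RHS]geo_linear; congr geo; apply/funext => k.
by rewrite mulrDl -mulrA.
Qed.

Lemma modulus_cesaro_resolvent x n :
  modulus (cesaro_resolvent t x) n <= 2 * geo t (modulus x) n.
Proof.
apply: le_trans (modulusD _ _ _) _; rewrite mulr_natl mulr2n.
apply: lerD; first exact: le_geo.
apply: le_trans (modulus_geo t01 _ n) _; apply: geo_le => // -[|k].
  (* At [k = 0] the quotient is [x 0 / 0 = 0]. *)
  by rewrite /modulus invr0 mulr0 normc0; exact: modulus_ge0.
rewrite /modulus normcZ normc_inv_nat ler_piMr ?normc_ge0//.
by rewrite invf_le1 ?ltr0n// ler1n.
Qed.

(** This is [n (T_[n] - P) x] after telescoping: [w - C w = x - P x], so only two end terms of the
    sum remain, whatever [n] is. *)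
Definition cesaro_defect n x : omega :=
  let w := cesaro_resolvent t (x - cesaro_proj t x) in C w - iter n.+1 C w.

Lemma cesaro_mean n x :
  \sum_(1 <= m < n.+1) iter m C x = n%:R *: cesaro_proj t x + cesaro_defect n x.
Proof.
rewrite /cesaro_defect; set w := cesaro_resolvent t _.
have wE : x = cesaro_proj t x + (w - C w).
  rewrite cesaro_resolventP; first by rewrite addrC subrK.
  (* The resolvent applies because [x - P x] vanishes at index [0]. *)
  by rewrite -[LHS]/(x 0%N - x 0%N * tC ^+ 0) expr0 mulr1 subrr.
elim: n => [|n IH]; first by rewrite big_geq// scale0r add0r subrr.
have linC := iter_cesaro_linear.
have CP m : iter m C (cesaro_proj t x) = cesaro_proj t x.
  by elim: m => [//|m IHm]; rewrite iterS IHm cesaro_proj_fix.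
have CE : iter n.+1 C x = cesaro_proj t x + (iter n.+1 C w - iter n.+2 C w).
  have linD u v : iter n.+1 C (u + v) = iter n.+1 C u + iter n.+1 C v.
    by have := linC n.+1 1 u v; rewrite !scale1r.
  have linB u v : iter n.+1 C (u - v) = iter n.+1 C u - iter n.+1 C v.
    by rewrite addrC -scaleN1r linC scaleN1r addrC.
  by rewrite {1}wE linD linB CP (iterSr n.+1).
rewrite big_nat_recr//= -/(iter n.+1 C x) CE IH -[n.+1%:R]natr1 scalerDl scale1r.
rewrite -/(iter n.+1 C w) -/(iter n.+2 C w).
by rewrite addrACA [C w - _ + _]addrA subrK.
Qed.

(** The constant is [8 = 2 * 2 * 2]: [1 - P] and the resolvent contribute a factor [2] each, and the
    defect is a difference of two powers applied to [w]. *)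
Lemma dominated_defect n : dominated (cesaro_defect n).
Proof.
split=> [a x y|x k]; rewrite /cesaro_defect /=.
  have -> : a *: x + y - cesaro_proj t (a *: x + y) =
      a *: (x - cesaro_proj t x) + (y - cesaro_proj t y).
    by rewrite cesaro_proj_linear scalerBr opprD addrACA.
  rewrite cesaro_resolvent_linear -!iterS iter_cesaro_linear cesaro_op_linear.
  by rewrite scalerBr opprD addrACA.
set w := cesaro_resolvent t _.
have zG m : modulus (x - cesaro_proj t x) m <= 2 * geo t (modulus x) m.
  apply: le_trans (modulusD _ _ _) _; rewrite mulr_natl mulr2n lerD ?le_geo//.
  by rewrite modulusN modulus_cesaro_proj.
have wG m : modulus w m <= 4 * geo t (geo t (modulus x)) m.
  apply: le_trans (modulus_cesaro_resolvent _ _) _.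
  have -> : 4 * geo t (geo t (modulus x)) m = 2 * (2 * geo t (geo t (modulus x)) m).
    by ring.
  rewrite ler_wpM2l//.
  by rewrite -geoZ; exact: geo_le.
have CG m : modulus (iter m C w) k <= 4 * geo3 x k.
  apply: le_trans (modulus_iter_cesaro t01 _ _ _) _.
  by rewrite /geo3 -geoZ; exact: geo_le.
apply: le_trans (modulusD _ _ _) _.
have -> : 8 * geo3 x k = 4 * geo3 x k + 4 * geo3 x k by ring.
rewrite lerD ?(CG 1%N)// modulusN.
exact: (CG n.+1).
Qed.

End dominated.

Section dominated_scale.
Context {R : realType} (t : R) (t01 : 0 <= t < 1) (S : scale R) (c : R).
Hypotheses (c0 : 0 <= c) (Sc : geo_bounded t S c).
Local Notation omega := (nat -> R[i]).
Implicit Types (x y : omega).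

Let t0 : 0 <= t. Proof. by case/andP: t01. Qed.

Lemma dominated_scale q x y : 1 <= q -> scale_set S q x ->
  (forall n, modulus y n <= 8 * geo3 t x n) ->
  scale_set S q y /\
  (lqnorm q (maj S y) <= (8 * c ^+ 3)%:E * lqnorm q (maj S x))%E.
Proof.
move=> q1.
have step u v : scale_set S q u -> (forall n, modulus v n <= geo t (modulus u) n) ->
    scale_set S q v /\ (lqnorm q (maj S v) <= c%:E * lqnorm q (maj S u))%E.
  move=> Su /(Sc q1 Su)[dv vu]; split => //; split => //.
  by apply: le_lt_trans vu _; rewrite lte_mul_pinfty//; case: Su.
(* The convolution of moduli is viewed as a complex sequence, so that it is again a member of the
   scale and the bound can be applied three times. *)
pose G (u : omega) : omega := fun n => ((geo t (modulus u) n)%:C)%C.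
have mG u : modulus (G u) = geo t (modulus u).
  apply/funext => n; rewrite /modulus normc_real// geo_ge0// => k.
  exact: modulus_ge0.
have stepG u : scale_set S q u ->
    scale_set S q (G u) /\ (lqnorm q (maj S (G u)) <= c%:E * lqnorm q (maj S u))%E.
  by move=> Su; apply: step => // n; rewrite mG.
move=> Sx yx.
have [S1 n1] := stepG _ Sx; have [S2 n2] := stepG _ S1.
have n8 : normc (8^-1 : R[i]) = 8^-1 by exact: normc_inv_nat.
(* Dividing by [8] puts [y] below one convolution of [G (G x)]; the factor is restored by
   homogeneity. *)
have [S3 n3] : scale_set S q (8^-1 *: y) /\
    (lqnorm q (maj S (8^-1 *: y)) <= c%:E * lqnorm q (maj S (G (G x))))%E.
  apply: step => // n; rewrite modulusZ n8 !mG ler_pdivrMl//; exact: yx.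
have yE : y = 8 *: (8^-1 *: y) + 0 by rewrite scalerA divff// scale1r addr0.
split; first by rewrite yE; apply: scale_setP => //; exact: scale_set0.
rewrite -[y in leLHS](scale1r y) -[1](@mulfV _ 8)// -scalerA.
have -> : maj S (8 *: (8^-1 *: y)) = fun n => 8 * maj S (8^-1 *: y) n.
  apply/funext => n; rewrite majZ; last by case: S3.
  by rewrite -(rmorph_nat (real_complex R)) normc_real.
rewrite lqnormZ// ger0_norm// EFinM -muleA lee_wpmul2l//.
apply: le_trans n3 _; rewrite exprS EFinM -muleA lee_wpmul2l ?lee_fin//.
apply: le_trans n2 _; rewrite expr2 EFinM -muleA lee_wpmul2l ?lee_fin//.
Qed.

End dominated_scale.

(** * Ergodic properties from equicontinuity of the dominated operators *)

Definition unit_seq (R : realType) (n : nat) : nat -> R[i] := fun k => (k == n)%:R.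

(** All that the ergodic argument uses of a space. Dominated operators act on sequences, hence the
    relational form [cd y = D (cd x)]; in [stable_equi], [W] is chosen before [D], which is
    equicontinuity at [0]. *)
Record dominated_stable (R : realType) (t : R) (X : tvsType R[i])
    (cd : X -> nat -> R[i]) : Prop := DominatedStable {
  stable_linear : linear cd;
  stable_inj : injective cd;
  stable_entourage : forall V : set (X * X), entourage V ->
    exists2 U : set X, nbhs 0 U & forall x y, U (x - y) -> V (x, y);
  stable_coord : forall n (e : R[i]), 0 < e -> \forall x \near 0, `|cd x n| < e;
  stable_unit : forall n, exists x, cd x = unit_seq R n;
  stable_act : forall D, dominated t D -> forall x, exists y, cd y = D (cd x);
  stable_equi : forall U : set X, nbhs 0 U ->
    exists2 W : set X, nbhs 0 W & forall D, dominated t D ->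
      forall x y, W x -> cd y = D (cd x) -> U y }.

Section dominated_theory.
Context {R : realType} (t : R) (t01 : 0 <= t < 1).
Context (X : tvsType R[i]) (cd : X -> nat -> R[i]) (HX : dominated_stable t cd).
Local Notation omega := (nat -> R[i]).
Local Notation tC := (t%:C)%C.
Local Notation C := (cesaro_op tC).

Let cdP : linear cd. Proof. exact: stable_linear HX. Qed.
Let cdD x y : cd (x + y) = cd x + cd y.
Proof. by have := cdP 1 x y; rewrite !scale1r. Qed.
Let cdZ a x : cd (a *: x) = a *: cd x.
Proof. exact: linear_funZ cdP. Qed.
Let cdB x y : cd (x - y) = cd x - cd y.
Proof. by rewrite cdD -scaleN1r cdZ scaleN1r. Qed.

Lemma dominated_lift D : dominated t D ->
  exists T : {linear X -> X}, forall x, cd (T x) = D (cd x).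
Proof.
move=> dD; have /choice[f fE] := stable_act HX dD.
have linf : linear f.
  by move=> a x y; apply: (stable_inj HX); rewrite cdP !fE cdP; case: dD => ->.
by exists (HB.pack_for {linear X -> X} f (GRing.isLinear.Build _ _ _ _ f linf)).
Qed.

Let near_sub (x : X) (W : set X) : nbhs 0 W -> \forall y \near x, W (x - y).
Proof.
move=> W0; have xx : (fun y => x - y) @ x --> x - x.
  apply: (@continuous_comp _ _ _ (fun y => (x, y)) (fun z : X * X => z.1 - z.2)).
    by apply: cvg_pair; [exact: cvg_cst|exact: cvg_id].
  exact: sub_continuous.
by apply: xx; rewrite subrr.
Qed.

(** Linearity translates equicontinuity at [0] to [x]. *)
Lemma dominated_equicontinuous (x : X) (V : set (X * X)) : entourage V ->
  \forall y \near x, forall (T : {linear X -> X}) D,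
    dominated t D -> (forall z, cd (T z) = D (cd z)) -> V (T x, T y).
Proof.
move=> /(stable_entourage HX)[U U0 UV]; have [W W0 WU] := stable_equi HX U0.
apply: filterS (near_sub x W0) => y Wxy T D dD TD; apply: UV.
by rewrite -linearB; apply: WU Wxy (TD _).
Qed.

Lemma dominated_continuous (T : {linear X -> X}) D :
  dominated t D -> (forall z, cd (T z) = D (cd z)) -> continuous T.
Proof.
move=> dD TD x; apply/cvg_entourageP => V /(dominated_equicontinuous x) xV.
by apply: filterS xV => y /(_ T D dD TD).
Qed.

Section cesaro_lift.
Variable T : {linear X -> X}.
Hypothesis TC : forall x, cd (T x) = C (cd x).

Lemma cesaro_lift_iter m x : cd (iter m T x) = iter m C (cd x).
Proof. by elim: m => [//|m IH]; rewrite !iterS TC IH. Qed.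

Lemma cesaro_lift_linear m : linear (iter m T).
Proof.
move=> a x y; apply: (stable_inj HX).
by rewrite cdP !cesaro_lift_iter cdP iter_cesaro_linear.
Qed.

Lemma cesaro_power_bounded : power_bounded T.
Proof.
move=> x V /(dominated_equicontinuous x) xV; apply: filterS xV => y xyV n _.
pose Tn : {linear X -> X} := HB.pack_for {linear X -> X} (iter n T)
  (GRing.isLinear.Build _ _ _ _ (iter n T) (cesaro_lift_linear n)).
apply: (xyV Tn (iter n C)); first exact: dominated_iter.
by move=> z; exact: cesaro_lift_iter.
Qed.

Lemma cesaro_mean_lift n x :
  cd (ergodic_mean T n x) = n%:R^-1 *: \sum_(1 <= m < n.+1) iter m C (cd x).
Proof.
rewrite cdZ; congr (_ *: _); elim: n => [|n IH].
  by rewrite !big_geq//; have := cdZ 0 0; rewrite !scale0r.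
by rewrite big_nat_recr//= [in RHS]big_nat_recr//= cdD IH -!iterS cesaro_lift_iter.
Qed.

(** A bounded [B] lies in [r W], and at [r w] the difference [P - T_[n]] is [-(r / n)] times the
    defect at [w], a dominated operator once [n >= |r|]. Equicontinuity then gives uniformity on
    [B]. *)
Lemma cesaro_uniformly_mean_ergodic : uniformly_mean_ergodic T.
Proof.
have [P PE] := dominated_lift (dominated_proj t01).
exists P; split; first exact: dominated_continuous (dominated_proj t01) PE.
apply/fam_cvgP => B Bb A /uniform_nbhs[V [/(stable_entourage HX)[U U0 UV] VA]].
have [W W0 WU] := stable_equi HX U0.
have [r r0 BW] := Bb _ W0.
(* A positive element of [R[i]] is real. *)
have rE : (normc r)%:C%C = r by rewrite -normr_normc gtr0_norm.
have : \forall n \near \oo, A (ergodic_mean T n).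
  exists (Num.truncn (normc r)).+1 => // n /= rn.
  apply: VA => y /BW[w Ww <-]; apply: UV.
  have n0 : (0 < n)%N by exact: leq_trans rn.
  have n0C : n%:R != 0 :> R[i] by rewrite pnatr_eq0 -lt0n.
  pose l := - (r / n%:R).
  apply: (WU (fun z => l *: cesaro_defect t n z) _ w) => //.
    apply: dominatedZ; last exact: dominated_defect.
    rewrite normcN normcZ normc_inv_nat ler_pdivrMr ?ltr0n// mul1r.
    apply: le_trans (ltW (truncnS_gt _)) _; by rewrite ler_nat.
  rewrite cdB PE cesaro_mean_lift cesaro_mean// scalerDr scalerA mulVf// scale1r.
  have [linP _] := dominated_proj t01; have [linD _] := dominated_defect t01 n.
  rewrite cdZ (linear_funZ _ _ linD).
  by rewrite opprD addNKr scalerA -scaleNr /l mulrC.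
by [].
Qed.

Lemma dense_meets (S : set X) (x : X) (A : set X) :
  dense S -> nbhs x A -> A `&` S !=set0.
Proof.
move=> dS; rewrite nbhsE => -[B [oB Bx] BA].
have [|y [By Sy]] := dS B _ oB; first by exists x.
by exists y; split => //; exact: BA.
Qed.

Lemma cesaro_not_supercyclic : ~ supercyclic T.
Proof.
move=> [x dx]; set S := (X in dense X) in dx.
pose phi (y : X) : R[i] := cd y 1%N - tC * cd y 0%N.
have orb y : S y -> exists l : R[i],
    cd y 0%N = l * cd x 0%N /\ normc (phi y) <= normc l * normc (phi x).
  move=> [l [n ->]]; exists l; rewrite /phi cdZ !cesaro_lift_iter.
  have it0 m : iter m C (cd x) 0%N = cd x 0%N.
    by elim: m => [//|m IH]; rewrite iterS cesaro_opE /= IH divr1.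
  split; first by rewrite -[LHS]/(l * _) it0.
  have -> : (l *: iter n C (cd x)) 1%N - tC * (l *: iter n C (cd x)) 0%N =
    l * (iter n C (cd x) 1%N - tC * iter n C (cd x) 0%N).
    by rewrite -[(l *: _) 1%N]/(l * _) -[(l *: _) 0%N]/(l * _); ring.
  rewrite normcZ ler_wpM2l ?normc_ge0//.
  elim: n => [//|n IH]; apply: le_trans IH; rewrite iterS !cesaro_opE /=.
  set u := iter n C _.
  have -> : (tC * u 0%N + u 1%N) / 2 - tC * (u 0%N / 1) =
      2^-1 * (u 1%N - tC * u 0%N).
    by field.
  by rewrite normcZ (normc_inv_nat 2) ler_piMl ?normc_ge0// invf_le1// ler1n.
have near_cd y n (e : R[i]) : 0 < e -> \forall z \near y, `|cd y n - cd z n| < e.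
  move=> e0; apply: filterS (near_sub y (stable_coord HX n e0)) => z.
  by rewrite cdB.
(* If [x_0 = 0], all multiples of the orbit have coordinate [0] equal to zero and stay away from the
   unit sequence at [0]. *)
have [x0|x0] := eqVneq (cd x 0%N) 0.
  have [y yE] := stable_unit HX 0.
  have := dense_meets dx (near_cd y 0%N 1 ltr01) => -[z [/= yz /orb[l [zE _]]]].
  by move: yz; rewrite zE x0 mulr0 subr0 yE normr1 ltxx.
(* Otherwise they satisfy [|phi z| <= M |z_0|], hence [|z_1| <= (M + 1) |z_0|], which excludes the
   unit sequence at [1]. *)
have [y yE] := stable_unit HX 1.
pose M := normc (phi x) / normc (cd x 0%N).
have a0 : 0 < normc (cd x 0%N).
  rewrite lt_def normc_ge0 andbT; apply: contra_neq x0.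
  exact: ComplexField.Normc.eq0_normc.
have M0 : 0 <= M by rewrite divr_ge0 ?normc_ge0.
(* This tolerance on [z_0] will force [|z_1| < 1/2], against [|1 - z_1| < 1/2]. *)
have M1 : 0 < 2^-1 / (M + 1) by rewrite divr_gt0 ?invr_gt0// ltr_wpDl.
have h0 : 0 < ((2^-1 / (M + 1))%:C)%C :> R[i] by rewrite ltcR.
have h1 : 0 < ((2^-1)%:C)%C :> R[i] by rewrite ltcR invr_gt0.
have [z [/= [z0 z1] /orb[l [zE phiz]]]] :=
  dense_meets dx (filterI (near_cd y 0%N _ h0) (near_cd y 1%N _ h1)).
move: z0 z1; rewrite yE /unit_seq/= sub0r normrN !normr_normc !ltcR => z0 z1.
have {}phiz : normc (phi z) <= M * normc (cd z 0%N).
  by rewrite zE normcZ mulrCA /M divfK ?gt_eqF.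
have t0 : 0 <= t <= 1 by case/andP: t01 => -> /ltW.
have z1le : normc (cd z 1%N) <= (M + 1) * normc (cd z 0%N).
  have -> : cd z 1%N = phi z + tC * cd z 0%N by rewrite /phi subrK.
  apply: le_trans (normcD _ _) _; rewrite mulrDl mul1r lerD// normcZ.
  by case/andP: t0 => t0 t1; rewrite normc_real// ler_piMl ?normc_ge0.
have : normc (cd z 1%N) < 2^-1.
  by apply: le_lt_trans z1le _; rewrite mulrC -ltr_pdivlMr// ltr_wpDl.
have : 1 <= normc (1 - cd z 1%N) + normc (cd z 1%N).
  rewrite -[leLHS](_ : normc 1 = 1); last exact: ComplexField.Normc.normc1.
  by rewrite -[in leLHS](subrK (cd z 1%N) 1) normcD.
lra.
Qed.

End cesaro_lift.

Theorem dominated_stable_cesaro : exists T : {linear X -> X},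
  [/\ forall x : X, cd (T x) = C (cd x), continuous T, power_bounded T,
      uniformly_mean_ergodic T & ~ supercyclic T].
Proof.
have [T TC] := dominated_lift (dominated_iter t01 1).
exists T; split => //.
- exact: dominated_continuous (dominated_iter t01 1) TC.
- exact: cesaro_power_bounded.
- exact: cesaro_uniformly_mean_ergodic.
- exact: cesaro_not_supercyclic.
Qed.

End dominated_theory.

(** * The gauge topology of an absorbing, convex and circled set *)

Lemma convex_setP (K : numDomainType) (E : lmodType K) (A : set E) :
  @convex_set K E A <->
  forall x y (a b : K), 0 <= a -> 0 <= b -> a + b = 1 -> A x -> A y ->
    A (a *: x + b *: y).
Proof.
split=> cA x y.
  move=> a b a0 b0 ab Ax Ay.
  have a1 : a <= 1 by rewrite -ab lerDl.
  have := cA x y (Itv01 a0 a1) (mem_set Ax) (mem_set Ay); rewrite inE /conv/=.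
  by rewrite /unstable.onem -[X in X - a]ab addrAC subrr add0r.
move=> l; rewrite !inE => Ax Ay; rewrite /conv/=; apply: cA => //.
  by rewrite unstable.onem_ge0.
by rewrite /unstable.onem addrCA subrr addr0.
Qed.

Section gauge.
Context {K : numFieldType} {E : lmodType K} (V : set E).

(* The proof is an argument because the topological structure attached to this
   alias of E is built from it. *)
Definition gauge_space
  (balV : forall (a : K) v, `|a| <= 1 -> V v -> V (a *: v)) : Type := E.

Hypothesis balV : forall (a : K) v, `|a| <= 1 -> V v -> V (a *: v).
Local Notation T := (gauge_space balV).

(** The topology of the Minkowski functional of [V], expressed through the sets [x + r V] so that no
    infimum has to exist in [K]. *)
Definition gauge_open : set_system E := [set A | forall x, A x ->
  exists2 r : K, 0 < r & forall v, V v -> A (x + r *: v)].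

Lemma gauge_openT : gauge_open setT.
Proof. by move=> x _; exists 1. Qed.

Lemma gauge_openI : setI_closed gauge_open.
Proof.
move=> A B oA oB x [Ax Bx].
have [r r0 rA] := oA x Ax; have [s s0 sB] := oB x Bx.
have rs0 : 0 < r + s by rewrite addr_gt0.
(* This radius is both [r] and [s] times a scalar of modulus at most [1], which [balV] absorbs. *)
exists (r * s / (r + s)); first by rewrite divr_gt0 ?mulr_gt0.
have le1 (a b : K) : 0 < a -> 0 < b -> `|b / (a + b)| <= 1.
  move=> a0 b0; have ab0 : 0 < a + b by rewrite addr_gt0.
  rewrite ger0_norm; last by rewrite divr_ge0// ltW.
  by rewrite ler_pdivrMr// mul1r lerDr ltW.
move=> v Vv; split.
  by rewrite -mulrA -scalerA; apply/rA/balV => //; exact: le1.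
rewrite [r * s]mulrC -mulrA -scalerA; apply/sB/balV => //.
by rewrite [r + s]addrC; exact: le1.
Qed.

Lemma gauge_open_bigU (I : Type) (f : I -> set E) :
  (forall i, gauge_open (f i)) -> gauge_open (\bigcup_i f i).
Proof.
move=> of_ x [i _ fx]; have [r r0 rf] := of_ i x fx.
by exists r => // v Vv; exists i => //; exact: rf.
Qed.

HB.instance Definition _ := Choice.on T.
HB.instance Definition _ := isOpenTopological.Build T
  gauge_openT gauge_openI gauge_open_bigU.

Hypothesis cvxV : @convex_set K E V.
Hypothesis absV : forall x, exists2 r : K, 0 < r & V (r *: x).

Let V0 : V 0.
Proof. by have [r _] := absV 0; rewrite scaler0. Qed.

(** The open ball: the Minkowski functional is below [r] at [y - x] when [(y - x) / r] can be
    enlarged by some [p > 1] within [V]. *)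
Definition gauge_ball (x : E) (r : K) : set E :=
  [set y | exists2 p : K, 1 < p & V ((p / r) *: (y - x))].

Let V_shrink (p q : K) v : 0 <= q -> q <= p -> V (p *: v) -> V (q *: v).
Proof.
move=> q0 qp; have [p0|p0] := eqVneq p 0.
  by have -> : q = p by apply/eqP; rewrite eq_le qp p0 q0.
have pp : 0 < p by rewrite lt_def p0 (le_trans q0).
move=> Vp; rewrite -(divfK p0 q) -scalerA; apply: balV => //.
by rewrite ger0_norm ?divr_ge0 ?(ltW pp)// ler_pdivrMr// mul1r.
Qed.

Lemma gauge_ball_center x r : gauge_ball x r x.
Proof. by exists 2; rewrite ?ltr1n// subrr scaler0. Qed.

Lemma gauge_ball_open x r : 0 < r -> gauge_open (gauge_ball x r).
Proof.
move=> r0 y [p p1 Vp].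
have p0 : 0 < p by exact: lt_trans p1.
(* With [q] between [1] and [p] and the radius below, the new difference scaled by [q / r] is a
   convex combination with weights [q / p] and [1 - q / p]. *)
pose q := (1 + p) / 2.
have q1 : 1 < q by rewrite ltr_pdivlMr// mul1r -[2]/(1 + 1) ltrD2l.
have q0 : 0 < q by exact: lt_trans q1.
have qp : q < p by rewrite ltr_pdivrMr// mulrDr mulr1 ltrD2r.
exists (r * (q^-1 - p^-1)); first by rewrite mulr_gt0// subr_gt0 ltf_pV2.
move=> w Vw; exists q => //.
have -> : (q / r) *: (y + (r * (q^-1 - p^-1)) *: w - x) =
    (q / p) *: ((p / r) *: (y - x)) + (1 - q / p) *: w.
  rewrite addrAC scalerDr !scalerA; congr (_ *: _ + _ *: _); field.
    by rewrite !gt_eqF.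
  by rewrite !gt_eqF.
move/convex_setP : cvxV; apply => //.
- by rewrite divr_ge0// ltW.
- by rewrite subr_ge0 ler_pdivrMr// mul1r ltW.
- by rewrite addrC subrK.
Qed.

Lemma gauge_ball_convex x r : 0 < r -> @convex_set K E (gauge_ball x r).
Proof.
move=> r0; apply/convex_setP => y z a b a0 b0 ab [p p1 Vp] [q q1 Vq].
(* [d] is below both [p - 1] and [q - 1], so [1 + d] is an admissible factor for both points. *)
pose d := (p - 1) * (q - 1) / ((p - 1) + (q - 1)).
have P : 0 < p - 1 by rewrite subr_gt0.
have Q : 0 < q - 1 by rewrite subr_gt0.
have PQ := addr_gt0 P Q.
have d0 : 0 < d by apply: divr_gt0 => //; exact: mulr_gt0.
have dp : d <= p - 1.
  by rewrite ler_pdivrMr// ler_pM2l// lerDr ltW.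
have dq : d <= q - 1.
  by rewrite ler_pdivrMr// [leLHS]mulrC ler_pM2l// lerDl ltW.
exists (1 + d); first by rewrite (ltrDl 1).
have -> : a *: y + b *: z - x = a *: (y - x) + b *: (z - x).
  by rewrite !scalerBr addrACA -opprD -scalerDl ab scale1r.
rewrite scalerDr !scalerA ![(1 + d) / r * _]mulrC.
rewrite -[(a * _) *: _]scalerA -[(b * _) *: _]scalerA.
have d1 : 0 <= (1 + d) / r.
  by apply: divr_ge0; [apply: addr_ge0|]; exact: ltW.
move/convex_setP : cvxV; apply => //.
  apply: V_shrink Vp => //; rewrite ler_pM2r ?invr_gt0//.
  by rewrite -lerBrDl.
apply: V_shrink Vq => //; rewrite ler_pM2r ?invr_gt0//.
by rewrite -lerBrDl.
Qed.

(** The set [x + r V] may fail to be open, but it contains the open ball of radius [r]. *)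
Lemma nbhs_gauge (x : E) (A : set E) : nbhs (x : T) A <->
  exists2 r : K, 0 < r & forall v, V v -> A (x + r *: v).
Proof.
split=> [|[r r0 rA]].
  rewrite nbhsE => -[B [/(_ x) oB /oB[r r0 rB]] BA].
  by exists r => // v /rB; exact: BA.
rewrite nbhsE; exists (gauge_ball x r).
  by split; [exact: gauge_ball_open|exact: gauge_ball_center].
move=> y [p p1 Vp]; have -> : y = x + r *: (r^-1 *: (y - x)).
  by rewrite scalerA divff ?gt_eqF// scale1r addrC subrK.
apply: rA; apply: V_shrink Vp; first by rewrite invr_ge0 ltW.
by rewrite ler_peMl ?(ltW p1)// invr_ge0 ltW.
Qed.

Lemma gauge_lc_topology : lc_topology (Topological.class T).
Proof.
have half_V r v w : V v -> V w ->
    exists2 u, V u & (r / 2) *: v + (r / 2) *: w = r *: u :> E.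
  move=> Vv Vw; exists (2^-1 *: v + 2^-1 *: w).
    by move/convex_setP : cvxV; apply; rewrite ?invr_ge0//; field.
  by rewrite scalerDr !scalerA.
split.
- move=> [x y] A /nbhs_gauge[r r0 rA].
  have r2 : 0 < r / 2 by rewrite divr_gt0.
  pose B (z : E) : set T := [set z + (r / 2) *: v | v in V].
  have BB z : nbhs (z : T) (B z).
    by apply/nbhs_gauge; exists (r / 2) => // v Vv; exists v.
  exists (B x, B y); first by split; exact: BB.
  move=> [x' y'] [/= [v Vv <-] [w Vw <-]].
  have [u Vu uE] := half_V r v w Vv Vw.
  by have := rA u Vu; rewrite -uE addrACA.
- move=> [l x] A /nbhs_gauge[r r0 rA].
  have r2 : 0 < r / 2 by rewrite divr_gt0.
  have [a a0 Vax] := absV x.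
  have d0 : 0 < a * (r / 2) by rewrite mulr_gt0.
  (* [m] bounds [|k|] when [|l - k| < a r / 2]. With [s = r / (2 m)], the difference
     [k (x + s v) - l x] splits into [(k - l) x] and [k s v], each in [(r / 2) V]. *)
  pose m := `|l| + a * (r / 2).
  have m0 : 0 < m by rewrite ltr_wpDl.
  have s0 : 0 < r / 2 / m by rewrite divr_gt0.
  exists ([set k : K^o | `|l - k| < a * (r / 2)],
          [set x + (r / 2 / m) *: v | v in V]).
    split; first by exists (a * (r / 2)).
    by apply/nbhs_gauge; exists (r / 2 / m) => // v Vv; exists v.
  move=> [k _] [/= kl [v Vv <-]].
  suff : A (k *: (x + (r / 2 / m) *: v)) by [].
  have -> : k *: (x + (r / 2 / m) *: v) = l *: x +
      ((r / 2) *: (((k - l) / (a * (r / 2))) *: (a *: x)) +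
       (r / 2) *: ((k / m) *: v)).
    rewrite scalerDr !scalerA addrA -scalerDl; congr (_ *: _ + _ *: _); field.
      by rewrite !gt_eqF.
    by rewrite gt_eqF.
  have V1 : V (((k - l) / (a * (r / 2))) *: (a *: x)).
    apply: balV => //; rewrite normf_div distrC [`|a * _|]gtr0_norm//.
    by rewrite ler_pdivrMr// mul1r ltW.
  have V2 : V ((k / m) *: v).
    apply: balV => //; rewrite normf_div [`|m|]gtr0_norm// ler_pdivrMr// mul1r.
    rewrite -[k](subrK l) addrC /m; apply: le_trans (ler_normD _ _) _.
    by rewrite lerD2l distrC ltW.
  by have [u Vu ->] := half_V r _ _ V1 V2; exact: rA.
- exists [set gauge_ball z.1 z.2 | z in [set z : E * K | 0 < z.2]].
    by move=> _ [[x r] /= r0 <-]; exact: gauge_ball_convex.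
  split; first by move=> _ [[x r] /= r0 <-]; exact: gauge_ball_open.
  move=> x A /nbhs_gauge[r r0 rA]; exists (gauge_ball x r).
    by split; [exists (x, r)|exact: gauge_ball_center].
  move=> y [p p1 Vp]; have -> : y = x + r *: (r^-1 *: (y - x)).
    by rewrite scalerA divff ?gt_eqF// scale1r addrC subrK.
  apply: rA; apply: V_shrink Vp; first by rewrite invr_ge0 ltW.
  by rewrite ler_peMl ?(ltW p1)// invr_ge0 ltW.
Qed.

End gauge.

(** * Dominated operators on the Banach spaces *)

Section spaces_stable.
Context {R : realType} (t : R) (t01 : 0 <= t < 1) (S : scale R) (c : R).
Hypotheses (c0 : 0 <= c) (Sc : geo_bounded t S c).
Hypothesis Scoord : forall n, exists2 M : R, 0 <= M &
  forall x, dom S x -> modulus x n <= M * maj S x n.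
Local Notation omega := (nat -> R[i]).

Section banach_stable.
Variables (q : R) (q1 : 1 <= q).
Local Notation B := (banach S q1).

Let q0 : 0 < q. Proof. exact: lt_le_trans q1. Qed.

Let normE (x : B) : `|x| = ((scale_norm S q (coords x))%:C)%C.
Proof. by []. Qed.

Lemma scale_norm_fine (x : B) :
  (scale_norm S q (coords x))%:E = lqnorm q (maj S (coords x)).
Proof.
rewrite fineK// ge0_fin_numE ?lqnorm_ge0//.
by have [] := set_mem (coordsP x).
Qed.

Lemma banach_act D : dominated t D ->
  forall x : B, exists y : B, coords y = D (coords x).
Proof.
move=> [_ DG] x.
have [Dx _] := dominated_scale t01 c0 Sc q1 (set_mem (coordsP x)) (DG (coords x)).
by exists (@Defs.SeqSub R (scale_linset S q1) _ (mem_set Dx)).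
Qed.

Lemma banach_norm_le D (x y : B) : dominated t D -> coords y = D (coords x) ->
  `|y| <= ((8 * c ^+ 3)%:C)%C * `|x|.
Proof.
move=> [_ DG] yE; rewrite !normE -rmorphM lecR -lee_fin EFinM !scale_norm_fine.
have [_] := dominated_scale t01 c0 Sc q1 (set_mem (coordsP x)) (DG (coords x)).
by rewrite yE.
Qed.

Lemma banach_coord_le n : exists2 M : R, 0 <= M &
  forall x : B, `|coords x n| <= (M%:C)%C * `|x|.
Proof.
have [M M0 xM] := Scoord n; exists M => // x.
have [dx _] := set_mem (coordsP x).
rewrite normr_normc normE -rmorphM lecR; apply: le_trans (xM _ dx) _.
rewrite ler_wpM2l// -lee_fin scale_norm_fine.
by apply: le_trans (lqnorm_ge _ n q0); rewrite ger0_norm// maj_ge0.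
Qed.

Lemma near0_scale_norm_lt (M : R) (e : R[i]) : 0 <= M -> 0 < e ->
  \forall x \near (0 : B), (M%:C)%C * `|x| < e.
Proof.
move=> M0 e0; have M1 : 0 < ((M + 1)%:C)%C :> R[i] by rewrite ltcR ltr_wpDl.
have d0 : 0 < e / ((M + 1)%:C)%C by rewrite divr_gt0.
apply: filterS (nbhs0_lt d0) => x; rewrite ltr_pdivlMr// mulrC; apply: le_lt_trans.
by rewrite ler_wpM2r// lecR lerDl.
Qed.

Lemma banach_coord n (e : R[i]) : 0 < e ->
  \forall x \near (0 : B), `|coords x n| < e.
Proof.
move=> e0; have [M M0 xM] := banach_coord_le n.
apply: filterS (near0_scale_norm_lt M0 e0) => x; exact: le_lt_trans.
Qed.

(** The constant [8 c^3] bounds all dominated operators, so one ball serves every [D]. *)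
Lemma banach_equi (U : set B) : nbhs 0 U ->
  exists2 W : set B, nbhs 0 W & forall D, dominated t D ->
    forall x y, W x -> coords y = D (coords x) -> U y.
Proof.
move=> /nbhs_normP[e /= e0 eU].
have M0 : 0 <= 8 * c ^+ 3 by rewrite mulr_ge0// exprn_ge0.
exists [set x : B | ((8 * c ^+ 3)%:C)%C * `|x| < e].
  exact: near0_scale_norm_lt.
move=> D dD x y /= xe yE; apply: eU; rewrite /= sub0r normrN.
exact: le_lt_trans (banach_norm_le dD yE) xe.
Qed.

Lemma banach_stable : (forall n, scale_set S q (unit_seq R n)) ->
  dominated_stable t (@coords R _ : B -> omega).
Proof.
move=> Su; split.
- exact: coords_linear.
- exact: coords_inj.
- move=> V; rewrite -entourage_ballE => -[e /= e0 eV].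
  exists [set x : B | `|x| < e]; first by have := @nbhs0_lt _ B e e0; apply.
  by move=> x y xy; apply: eV; rewrite /= -ball_normE.
- exact: banach_coord.
- by move=> n; exists (@Defs.SeqSub R (scale_linset S q1) _ (mem_set (Su n))).
- exact: banach_act.
- exact: banach_equi.
Qed.

End banach_stable.

Lemma lcsup_entourage (E : lmodType R[i]) (P : Topological E -> Prop)
    (P_lc : forall c, P c -> lc_topology c) (V : set (lcsup P_lc * lcsup P_lc)) :
  entourage V ->
  exists2 U : set (lcsup P_lc), nbhs 0 U & forall x y, U (x - y) -> V (x, y).
Proof.
move=> [U [U0 UV]]; exists U => // x y Uxy.
by apply/set_mem/(UV (x, y))/mem_set.
Qed.

(** * Dominated operators on the Frechet spaces *)

Section frechet_stable.
Variables (qs : nat -> R) (qs1 : forall k, 1 <= qs k).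
Local Notation F := (frechet S qs1).

Lemma frechet_incl_continuous k :
  continuous (frechet_incl S qs1 k : F -> banach S (qs1 k)).
Proof.
move=> x; apply: (cvg_trans _ (@initial_continuous _ _ (frechet_incl S qs1 k) x)).
apply: cvg_app.
exact: (@topsup_id _ (@frechet_topology _ S qs qs1) _ (ex_intro _ k erefl) x).
Qed.

Let incl0 k : frechet_incl S qs1 k 0 = 0. Proof. exact: linear0. Qed.

Lemma frechet_stable : (forall k n, scale_set S (qs k) (unit_seq R n)) ->
  dominated_stable t (@coords R _ : F -> omega).
Proof.
move=> Su; split.
- exact: coords_linear.
- exact: coords_inj.
- exact: lcsup_entourage.
- move=> n e e0; have := @frechet_incl_continuous 0 0; rewrite /continuous_at incl0.
  by move=> /(_ _ (banach_coord (qs1 0%N) n e0)).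
- move=> n; have Fu : frechet_set S qs (unit_seq R n) by move=> k _; exact: Su.
  by exists (@Defs.SeqSub R (frechet_linset S qs1) _ (mem_set Fu)).
- move=> D dD x.
  have FD : frechet_set S qs (D (coords x)).
    move=> k _; have [y <-] := banach_act dD (frechet_incl S qs1 k x).
    exact: set_mem (coordsP y).
  by exists (@Defs.SeqSub R (frechet_linset S qs1) _ (mem_set FD)).
(* The sets [U] meeting the requirement form a filter, and the requirement says that it converges to
   [0]. In a supremum of topologies, convergence is checked on each of them. *)
- pose G : set_system F := [set U | exists2 W : set F, nbhs 0 W &
    forall D, dominated t D -> forall x y, W x -> coords y = D (coords x) -> U y].
  have GF : Filter G.
    split.
    + by exists setT => //; exact: filterT.
    + move=> A A' [W W0 WA] [W' W'0 WA']; exists (W `&` W'); first exact: filterI.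
      by move=> D dD x y [Wx W'x] yE; split; [exact: WA yE|exact: WA' yE].
    + move=> A A' AA' [W W0 WA]; exists W => // D dD x y Wx yE.
      by apply: AA'; exact: WA yE.
  suff : G --> (0 : F) by move=> + U; exact.
  apply/cvg_topsup => _ [k ->] A /= [_ [[U oU <-] /= U0] UA].
  have U0' : nbhs (0 : banach S (qs1 k)) U.
    by rewrite -(incl0 k); exact: open_nbhs_nbhs.
  have [W W0 WU] := banach_equi U0'.
  exists (frechet_incl S qs1 k @^-1` W).
    by apply: frechet_incl_continuous; rewrite incl0.
  move=> D dD x y Wx yE; apply: UA; apply: (WU D dD _ _ Wx); exact: yE.
Qed.

End frechet_stable.

(** * Dominated operators on the inductive limits *)

Section lb_stable.
Variables (qs : nat -> R) (qs1 : forall k, 1 <= qs k) (incr_qs : increasing_seq qs).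
Local Notation L := (lb S qs1 incr_qs).

Let incl0 k : lb_incl S qs1 incr_qs k 0 = 0. Proof. exact: linear0. Qed.

(* A convex circled set is a neighborhood of 0 in the inductive limit as soon
   as its trace on each step is one: its gauge topology is then admissible. *)
Lemma nbhs0_lb (V : set (seqsub (lb_linset S qs1 incr_qs))) :
  (forall (a : R[i]) v, `|a| <= 1 -> V v -> V (a *: v)) ->
  @convex_set R[i] (seqsub (lb_linset S qs1 incr_qs)) V ->
  (forall k, nbhs (0 : banach S (qs1 k)) (lb_incl S qs1 incr_qs k @^-1` V)) ->
  nbhs (0 : L) V.
Proof.
move=> balV cvxV nV.
(* Absorption: every vector lies in some step, where [V] contains a ball around [0]. *)
have absV (x : seqsub (lb_linset S qs1 incr_qs)) :
    exists2 r : R[i], 0 < r & V (r *: x).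
  have [k _ xk] := set_mem (coordsP x).
  pose y : banach S (qs1 k) :=
    @Defs.SeqSub R (scale_linset S (qs1 k)) _ (mem_set xk).
  have xE : x = lb_incl S qs1 incr_qs k y by exact: coords_inj.
  have /nbhs_normP[e /= e0 eV] := nV k.
  have y1 : 0 < `|y| + 1 by rewrite ltr_wpDl.
  exists (e / (`|y| + 1)); first by rewrite divr_gt0.
  rewrite xE -linearZ; apply: eV; rewrite /= sub0r normrN normrZ.
  rewrite gtr0_norm ?divr_gt0// mulrAC ltr_pdivrMr// ltr_pM2l//.
  by rewrite ltrDl.
have adm : @lb_admissible R S qs qs1 incr_qs (Topological.class (gauge_space balV)).
  split; first exact: (gauge_lc_topology balV cvxV absV).
  move=> k x A /(nbhs_gauge balV cvxV absV)[r r0 rA].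
  have r0' : r != 0 by rewrite gt_eqF.
  have /nbhs_normP[e /= e0 eV] := nV k.
  suff : nbhs x (lb_incl S qs1 incr_qs k @^-1` A) by [].
  apply/(@nbhs_normP _ (banach S (qs1 k))).
  exists (r * e); first by rewrite /= mulr_gt0.
  move=> y /= xy.
  have -> : lb_incl S qs1 incr_qs k y = lb_incl S qs1 incr_qs k x +
      r *: lb_incl S qs1 incr_qs k (r^-1 *: (y - x)).
    by rewrite linearZ/= scalerA divff// scale1r linearB addrC subrK.
  apply: rA; apply: eV; rewrite /= sub0r normrN normrZ normfV gtr0_norm//.
  by rewrite ltr_pdivrMl// distrC.
apply: (lb_finest adm).
apply/(nbhs_gauge balV cvxV absV); exists 1 => // v Vv.
by rewrite scale1r add0r.
Qed.

Lemma lb_act D : dominated t D ->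
  forall x : L, exists y : L, coords y = D (coords x).
Proof.
move=> dD x; have [k _ xk] := set_mem (coordsP x).
pose x' : banach S (qs1 k) := @Defs.SeqSub R (scale_linset S (qs1 k)) _ (mem_set xk).
have [y' y'E] := banach_act dD x'.
by exists (lb_incl S qs1 incr_qs k y').
Qed.

(** [V] collects the vectors whose dominated images all lie in a convex [U0] inside [U]. It is
    convex and circled, and its trace on each step is a neighborhood of [0] by the Banach case. *)
Lemma lb_equi (U : set L) : nbhs 0 U ->
  exists2 W : set L, nbhs 0 W & forall D, dominated t D ->
    forall x y, W x -> coords y = D (coords x) -> U y.
Proof.
have [B cB [oB Bx]] := @locally_convex _ L.
move=> /(Bx 0)[U0 [BU0 U00] U0U].
have cU0 := cB _ (mem_set BU0).
have nU0 : nbhs (0 : L) U0 by apply: open_nbhs_nbhs; split => //; exact: oB.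
pose V : set L := [set x | forall D, dominated t D ->
  forall y : L, coords y = D (coords x) -> U0 y].
exists V; last by move=> D dD x y Vx yE; apply: U0U; exact: Vx yE.
apply: nbhs0_lb.
(* [U0] is only known to be convex; [V] is circled because the scalar moves into the operator. *)
- move=> a v a1 Vv D dD y yE; apply: (Vv (fun x => a *: D x)).
    by apply: dominatedZ => //; rewrite -lecR -normr_normc.
  rewrite yE; have [linD _] := dD; exact: (GRing.scalable_linear linD).
- apply/convex_setP => x y a b a0 b0 ab Vx Vy D dD z zE.
  have [x' x'E] := lb_act dD x; have [y' y'E] := lb_act dD y.
  have -> : z = a *: x' + b *: y'.
    apply: coords_inj; rewrite zE.
    have coordsD (u v : L) :
        coords (a *: u + b *: v) = a *: coords u + b *: coords v.
      by [].
    have [linD _] := dD.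
    by rewrite !coordsD x'E y'E linD (linear_funZ _ _ linD).
  move/convex_setP : cU0; apply => //; [exact: Vx x'E|exact: Vy y'E].
- move=> k.
  have : nbhs (0 : banach S (qs1 k)) (lb_incl S qs1 incr_qs k @^-1` U0).
    by apply: lb_incl_continuous; rewrite incl0.
  move=> /banach_equi[W W0 WU]; apply: filterS W0 => x Wx D dD y yE.
  have [y' y'E] := banach_act dD x.
  have -> : y = lb_incl S qs1 incr_qs k y' by apply: coords_inj; rewrite yE -y'E.
  exact: WU y'E.
Qed.

Lemma lb_stable : (forall k n, scale_set S (qs k) (unit_seq R n)) ->
  dominated_stable t (@coords R _ : L -> omega).
Proof.
move=> Su; split.
- exact: coords_linear.
- exact: coords_inj.
- exact: lcsup_entourage.
- move=> n e e0; apply: nbhs0_lb.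
  + move=> a v a1 /= ve; apply: le_lt_trans ve.
    by rewrite -[X in `|X|]/(a * coords v n) normrM ler_piMl.
  + apply/convex_setP => x y a b a0 b0 ab /= xe ye.
    rewrite -[X in `|X|]/(a * coords x n + b * coords y n).
    apply: le_lt_trans (ler_normD _ _) _.
    rewrite !normrM (ger0_norm a0) (ger0_norm b0).
    (* The strict inequality is carried by the weight [a], which must be positive for this. *)
    have [a00|a00] := eqVneq a 0.
      by move: ab; rewrite a00 mul0r !add0r => ->; rewrite mul1r.
    have a1 : 0 < a by rewrite lt_def a00.
    rewrite -[ltRHS]mul1r -ab mulrDl ltr_leD// ?ltr_pM2l//.
    by rewrite ler_wpM2l// ltW.
  + by move=> k; exact: banach_coord.
- move=> n; have Lu : lb_set S qs (unit_seq R n) by exists 0%N.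
  by exists (@Defs.SeqSub R (lb_linset S qs1 incr_qs) _ (mem_set Lu)).
- exact: lb_act.
- exact: lb_equi.
Qed.

End lb_stable.

End spaces_stable.

(** * Unit sequences and coordinate bounds on the scales *)

Section unit_sequences.
Context {R : realType}.
Local Notation omega := (nat -> R[i]).
Implicit Types (q : R) (n : nat).

(** Bounds [s / y^(s+1)] by [x^(-s) - y^(-s)] for [x = m + 1], [y = m + 2]: this reduces to
    [1 + s / y <= (y / x)^s], which follows from [ln (y / x) >= 1 / y]. *)
Lemma powR_inv_step (s : R) m : 0 < s ->
  s * (m.+2%:R^-1 `^ (s + 1)) + m.+2%:R^-1 `^ s <= m.+1%:R^-1 `^ s.
Proof.
move=> s0; pose x : R := m.+1%:R; pose y : R := m.+2%:R.
have x0 : 0 < x by rewrite ltr0n.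
have y0 : 0 < y by rewrite ltr0n.
have y1 : y^-1 != 0 by rewrite invr_eq0 gt_eqF.
rewrite powRD ?y1 ?implybT// powRr1 ?invr_ge0 ?ler0n// -/x -/y.
have -> : s * (y^-1 `^ s * y^-1) + y^-1 `^ s = y^-1 `^ s * (1 + s / y) by ring.
have -> : x^-1 `^ s = y^-1 `^ s * (y / x) `^ s.
  rewrite -powRM ?invr_ge0 ?divr_ge0 ?ler0n//; congr (_ `^ _); field.
  by rewrite !gt_eqF.
rewrite ler_wpM2l ?powR_ge0//.
have yx0 : 0 < y / x by rewrite divr_gt0.
rewrite /powR gt_eqF//; apply: le_trans (expR_ge1Dx _); rewrite lerD2l.
rewrite ler_wpM2l ?(ltW s0)//.
rewrite -[y / x]invrK lnV ?posrE ?invr_gt0// lerNr invf_div.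
have -> : x / y = 1 + (- y^-1).
  have -> : x = y - 1 by rewrite /y -[m.+2%:R]natr1 addrK.
  by field; rewrite gt_eqF.
by apply: le_ln1Dx; rewrite ltrN2 invf_lt1// ltr1n.
Qed.

(** Telescoping the previous estimate with [s = q - 1] bounds all partial sums by [(s + 1) / s]. *)
Lemma lqnorm_harmonic q : 1 < q ->
  (lqnorm q (fun k => k.+1%:R^-1 : R)%R < +oo)%E.
Proof.
move=> q1; have q0 : 0 < q by exact: lt_trans q1.
pose s := q - 1; have s0 : 0 < s by rewrite subr_gt0.
have sum_le N : s * (\sum_(k < N.+1) (k.+1%:R^-1 `^ q)) + N.+1%:R^-1 `^ s <= s + 1.
  elim: N => [|N IH]; first by rewrite big_ord1 invr1 !powR1 mulr1.
  apply: le_trans IH; rewrite big_ord_recr/= mulrDr -addrA lerD2l.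
  by have := powR_inv_step N s0; rewrite /s subrK.
rewrite lqnorm_ltyE//; apply: (@le_lt_trans _ _ ((s + 1) / s)%:E); last exact: ltry.
apply: lime_le; first by apply: is_cvg_nneseries => n _ _; rewrite lee_fin powR_ge0.
apply: nearW => N; rewrite big_mkord sumEFin lee_fin ler_pdivlMr// mulrC.
apply: le_trans (sum_le N); rewrite big_ord_recr/= mulrDr -addrA.
under eq_bigr do rewrite ger0_norm ?invr_ge0//.
by rewrite lerDl addr_ge0 ?powR_ge0// mulr_ge0 ?powR_ge0// ltW.
Qed.

Lemma modulus_unit n k : modulus (unit_seq R n) k = (k == n)%:R.
Proof.
by rewrite /modulus /unit_seq -(rmorph_nat (real_complex R)) normc_real.
Qed.

Lemma scale_unit_ell q n : 1 <= q -> scale_set ell q (unit_seq R n).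
Proof.
move=> q1; have q0 : 0 < q by exact: lt_le_trans q1.
split => //=; apply: le_lt_trans (lqnorm_trunc_lty (fun=> 1) n.+1 q0).
apply: lqnorm_le => // k; rewrite modulus_unit.
by have [->|_] := eqVneq k n; [rewrite ltnSn|rewrite normr0].
Qed.

Lemma scale_unit_d q n : 1 <= q -> scale_set Defs.dscale q (unit_seq R n).
Proof.
move=> q1; have q0 : 0 < q by exact: lt_le_trans q1.
have u1 k : modulus (unit_seq R n) k <= 1.
  by rewrite modulus_unit; case: (k == n).
split; first by exists 1.
apply: le_lt_trans (lqnorm_trunc_lty (fun=> 1) n.+1 q0).
apply: lqnorm_le => // k /=; rewrite ger0_norm ?hat_ge0//.
case: ifPn => [_|]; first by rewrite normr1; exact: hat_le.
rewrite -leqNgt => nk; rewrite normr0; apply: hat_le => j kj.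
by rewrite modulus_unit gtn_eqF// (leq_trans nk).
Qed.

Lemma scale_unit_ces q n : 1 < q -> scale_set ces q (unit_seq R n).
Proof.
move=> q1; have q0 : 0 < q by exact: lt_trans q1.
split => //=; apply: le_lt_trans (lqnorm_harmonic q1).
apply: lqnorm_le => // k; rewrite !ger0_norm ?invr_ge0 ?cesaro_modulus_ge0//.
rewrite cesaro_modulusE ler_piMl ?invr_ge0//.
under eq_bigr do rewrite modulus_unit.
(* The sum counts the indices [j <= k] equal to [n], at most one. *)
rewrite -natr_sum lern1 -big_mkcond/= sum1_card.
rewrite -(cards1 (inord n : 'I_k.+1)).
apply/subset_leq_card/fintype.subsetP => j; rewrite !inE => /eqP jn.
by rewrite -jn inord_val.
Qed.

Lemma coord_le_ell n : exists2 M : R, 0 <= M &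
  forall x : omega, dom ell x -> modulus x n <= M * maj ell x n.
Proof. by exists 1 => // x _; rewrite mul1r. Qed.

Lemma coord_le_d n : exists2 M : R, 0 <= M &
  forall x : omega, dom Defs.dscale x -> modulus x n <= M * maj Defs.dscale x n.
Proof. by exists 1 => // x dx; rewrite mul1r; exact: le_hat. Qed.

Lemma coord_le_ces n : exists2 M : R, 0 <= M &
  forall x : omega, dom ces x -> modulus x n <= M * maj ces x n.
Proof.
exists n.+1%:R => // x _ /=; rewrite cesaro_modulusE mulrC divfK ?pnatr_eq0//.
by rewrite big_ord_recr/= lerDr sumr_ge0// => k _; exact: modulus_ge0.
Qed.

End unit_sequences.

Theorem theorem6p6 (R : realType) (t : R) (ht : 0 <= t < 1)
  (X : seq_space R) (hX : cesaro_space X) :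
  exists T : {linear X -> X},
    [/\ forall x : X, seq_coords (T x) = cesaro_op (t%:C)%C (seq_coords x),
        continuous T,
        power_bounded T,
        uniformly_mean_ergodic T &
        ~ supercyclic T].
Proof.
apply: (dominated_stable_cesaro ht).
have t1 : 0 <= (1 - t)^-1 by rewrite invr_ge0 subr_ge0 ltW//; case/andP: ht.
have t2 : 0 <= (1 - t)^-1 * (1 - t)^-1 by rewrite mulr_ge0.
have gell := geo_bounded_ell ht; have gces := geo_bounded_ces ht.
have gd := geo_bounded_d ht.
case: hX => [p p1|p p1|p p1|p qs qs1 p1 [qsp _ _]|p qs qs1 p1 [qsp _ _]
    |p qs qs1 p1 [qsp _ _]|p qs qs1 iqs _ [qs1' _ _]|p qs qs1 iqs _ [qs1' _ _]
    |p qs qs1 iqs _ [qs1' _ _]] /=.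
- apply: (banach_stable ht t2 gd coord_le_d p1) => n; exact: scale_unit_d.
- apply: (banach_stable ht t1 gell coord_le_ell p1) => n; exact: scale_unit_ell.
- apply: (banach_stable ht t1 gces coord_le_ces (ltW p1)) => n; exact: scale_unit_ces.
- apply: (frechet_stable ht t1 gell coord_le_ell qs1) => k n; exact: scale_unit_ell.
- apply: (frechet_stable ht t1 gces coord_le_ces qs1) => k n.
  (* The harmonic bound requires an exponent above [1]; here [qs k > p >= 1]. *)
  by apply: scale_unit_ces; exact: le_lt_trans (qsp k).
- apply: (frechet_stable ht t2 gd coord_le_d qs1) => k n; exact: scale_unit_d.
- apply: (lb_stable ht t1 gell coord_le_ell qs1 iqs) => k n; exact: scale_unit_ell.
- apply: (lb_stable ht t1 gces coord_le_ces qs1 iqs) => k n; exact: scale_unit_ces.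
- apply: (lb_stable ht t2 gd coord_le_d qs1 iqs) => k n; exact: scale_unit_d.
Qed.
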